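(* The ring $\mathcal{D}$ of doubly symmetric functions is isomorphic to $\mathcal{S}/\mathcal{I}$, the ring of symmetric functions modulo the ideal $\mathcal{I}$ generated by all differences $S_\lambda-S_{\lambda'}$, $\lambda$ a partition.
   Context: $\mathcal{S}$ is the algebra of symmetric functions over $\mathbb{Q}$, with basis the Schur functions $S_\lambda$ indexed by all partitions $\lambda$ (including the empty one); $\lambda'$ is the conjugate partition. Hook Schur functions: for finite, possibly empty, lists of variables $X=(x_1,\ldots,x_k)$, $Y=(y_1,\ldots,y_\ell)$, a $(k,\ell)$-semistandard tableau of shape $\lambda$ is a filling of the Young diagram of $\lambda$ with entries from the ordered alphabet $1<2<\cdots<k<1'<\cdots<\ell'$ such that entries are non-decreasing in each row and each column, unprimed symbols may repeat in rows but not in columns, and primed symbols may repeat in columns but not in rows. Then $HS_\lambda(X;Y)=\sum_T x^T$, summed over all such tableaux $T$, where $x^T=\prod_j x_j^{\#\{j \text{ in } T\}}\prod_j y_j^{\#\{j'\text{ in }T\}}$. A symmetric function $\sum_\lambda m_\lambda S_\lambda$ is doubly symmetric if for all finite (possibly empty) sets of variables $X,Y$ one has $\sum_\lambda m_\lambda S_\lambda(X,Y)=\sum_\lambda m_\lambda HS_\lambda(X;Y)$, where $S_\lambda(X,Y)$ is the Schur polynomial in all the variables of $X$ and $Y$ together. $\mathcal{D}\subseteq\mathcal{S}$ is the set of all doubly symmetric functions. *)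

(* Defs.v *)
From HB Require Import structures.
From mathcomp Require Import all_boot all_order all_algebra.
From mathcomp Require Import ring_quotient.
From mathcomp Require Import finmap mpoly.
From mathcomp Require Import boolp.

Set Implicit Arguments.
Unset Strict Implicit.
Unset Printing Implicit Defensive.

Import GRing.Theory.
Local Open Scope ring_scope.

Definition is_part (sh : seq nat) : bool := sorted geq sh && (0%N \notin sh).

Record intpart := IntPart { parts :> seq nat; _ : is_part parts }.
HB.instance Definition _ := [isSub for parts].
HB.instance Definition _ := [Countable of intpart by <:].

Lemma intpartP (la : intpart) : is_part la. Proof. by case: la. Qed.

(* The j-th part (from 0) of the conjugate is the length of the j-th column,
   i.e. the number of parts of la exceeding j. *)
Definition conj_seq (sh : seq nat) : seq nat :=
  [seq count (fun r => j < r)%N sh | j <- iota 0 (head 0%N sh)].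

Lemma conj_seq_part (la : intpart) : is_part (conj_seq la).
Proof.
apply/andP; split.
  apply: (homo_sorted (e := leq)); last exact: iota_sorted.
  move=> i j le_ij; apply: sub_count => r; exact: leq_ltn_trans.
apply/mapP => -[j]; rewrite mem_iota add0n /=; case: (parts la) => [|r s] //=.
by move=> ->.
Qed.

Definition conj_part (la : intpart) : intpart := IntPart (conj_seq_part la).

(* The boxes of the Young diagram: pairs (row i, column j) with j < la_i. *)
Definition box (la : intpart) : finType :=
  {i : 'I_(size la) & 'I_(nth 0%N la i)}.
Definition brow (la : intpart) (b : box la) : nat := tag b.
Definition bcol (la : intpart) (b : box la) : nat := tagged b.

Definition content (n : nat) (la : intpart) (T : {ffun box la -> 'I_n}) :
    {mpoly rat[n]} :=
  \prod_(j < n) 'X_j ^+ #|[set b | T b == j]|.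

Definition semistandard (n : nat) (la : intpart)
    (T : {ffun box la -> 'I_n}) : bool :=
  [forall b : box la, forall c : box la,
     ((brow b == brow c) && (bcol b < bcol c)%N ==> (T b <= T c)%N)
  && ((bcol b == bcol c) && (brow b < brow c)%N ==> (T b < T c)%N)].

Definition schur_poly (n : nat) (la : intpart) : {mpoly rat[n]} :=
  \sum_(T : {ffun box la -> 'I_n} | semistandard T) content T.

(* The alphabet 1 < ... < k < 1' < ... < l' is 'I_(k + l): the letters a with
   a < k are the unprimed ones, those with k <= a the primed ones; likewise
   the variables x_1, ..., x_k, y_1, ..., y_l are 'X_0, ..., 'X_(k + l - 1). *)
Definition hook_semistandard (k l : nat) (la : intpart)
    (T : {ffun box la -> 'I_(k + l)}) : bool :=
  [forall b : box la, forall c : box la,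
     ((brow b == brow c) && (bcol b < bcol c)%N ==>
        (T b <= T c)%N && ((T b == T c) ==> (T b < k)%N))
  && ((bcol b == bcol c) && (brow b < brow c)%N ==>
        (T b <= T c)%N && ((T b == T c) ==> (k <= T b)%N))].

Definition hook_schur (k l : nat) (la : intpart) : {mpoly rat[k + l]} :=
  \sum_(T : {ffun box la -> 'I_(k + l)} | hook_semistandard T) content T.

Definition mpolyseq : Type := forall n : nat, {mpoly rat[n]}.

HB.instance Definition _ := Choice.copy mpolyseq (forall n : nat, {mpoly rat[n]}).

Section MpolySeqRing.
Implicit Types f g h : mpolyseq.

Definition mpolyseq_zero : mpolyseq := fun n => 0.
Definition mpolyseq_one : mpolyseq := fun n => 1.
Definition mpolyseq_opp f : mpolyseq := fun n => - f n.
Definition mpolyseq_add f g : mpolyseq := fun n => f n + g n.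
Definition mpolyseq_mul f g : mpolyseq := fun n => f n * g n.
Definition mpolyseq_scale (a : rat) f : mpolyseq := fun n => a *: f n.

Lemma mpolyseqP f g : (forall n, f n = g n) -> f = g.
Proof. exact: functional_extensionality_dep. Qed.

Fact mpolyseq_addA : associative mpolyseq_add.
Proof. by move=> f g h; apply: mpolyseqP => n; apply: addrA. Qed.
Fact mpolyseq_addC : commutative mpolyseq_add.
Proof. by move=> f g; apply: mpolyseqP => n; apply: addrC. Qed.
Fact mpolyseq_add0 : left_id mpolyseq_zero mpolyseq_add.
Proof. by move=> f; apply: mpolyseqP => n; apply: add0r. Qed.
Fact mpolyseq_addN : left_inverse mpolyseq_zero mpolyseq_opp mpolyseq_add.
Proof. by move=> f; apply: mpolyseqP => n; apply: addNr. Qed.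

HB.instance Definition _ := GRing.isZmodule.Build mpolyseq
  mpolyseq_addA mpolyseq_addC mpolyseq_add0 mpolyseq_addN.

Fact mpolyseq_mulA : associative mpolyseq_mul.
Proof. by move=> f g h; apply: mpolyseqP => n; apply: mulrA. Qed.
Fact mpolyseq_mulC : commutative mpolyseq_mul.
Proof. by move=> f g; apply: mpolyseqP => n; apply: mulrC. Qed.
Fact mpolyseq_mul1 : left_id mpolyseq_one mpolyseq_mul.
Proof. by move=> f; apply: mpolyseqP => n; apply: mul1r. Qed.
Fact mpolyseq_mulD : left_distributive mpolyseq_mul mpolyseq_add.
Proof. by move=> f g h; apply: mpolyseqP => n; apply: mulrDl. Qed.
Fact mpolyseq_one_neq0 : mpolyseq_one != mpolyseq_zero.
Proof.
by apply/eqP => /(congr1 (fun f : mpolyseq => f 0%N)) /eqP; rewrite oner_eq0.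
Qed.

HB.instance Definition _ := GRing.Zmodule_isComNzRing.Build mpolyseq
  mpolyseq_mulA mpolyseq_mulC mpolyseq_mul1 mpolyseq_mulD mpolyseq_one_neq0.

Fact mpolyseq_scaleA a b f :
  mpolyseq_scale a (mpolyseq_scale b f) = mpolyseq_scale (a * b) f.
Proof. by apply: mpolyseqP => n; apply: scalerA. Qed.
Fact mpolyseq_scale1 : left_id 1 mpolyseq_scale.
Proof. by move=> f; apply: mpolyseqP => n; apply: scale1r. Qed.
Fact mpolyseq_scaleDr : right_distributive mpolyseq_scale +%R.
Proof. by move=> a f g; apply: mpolyseqP => n; apply: scalerDr. Qed.
Fact mpolyseq_scaleDl f : {morph mpolyseq_scale^~ f : a b / a + b}.
Proof. by move=> a b; apply: mpolyseqP => n; apply: scalerDl. Qed.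

HB.instance Definition _ := GRing.Zmodule_isLmodule.Build rat mpolyseq
  mpolyseq_scaleA mpolyseq_scale1 mpolyseq_scaleDr mpolyseq_scaleDl.

Fact mpolyseq_scaleAl (a : rat) f g : a *: (f * g) = a *: f * g.
Proof. by apply: mpolyseqP => n; apply: scalerAl. Qed.

HB.instance Definition _ :=
  GRing.Lmodule_isLalgebra.Build rat mpolyseq mpolyseq_scaleAl.
HB.instance Definition _ := GRing.Lalgebra_isComAlgebra.Build rat mpolyseq.

End MpolySeqRing.

(* The specialisation x_n := 0 of the last variable. *)
Definition drop_last (n : nat) (p : {mpoly rat[n.+1]}) : {mpoly rat[n]} :=
  p \mPo [tuple if unlift ord_max i is Some j then 'X_j else 0 | i < n.+1].

(* Symmetric functions in countably many variables, as the graded inverse limit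
   of the rings of symmetric polynomials: f n is the specialisation of the
   symmetric function to its first n variables. *)
Definition symfun_pred : {pred mpolyseq} := fun f => `[<
  [/\ forall n, f n \is symmetric,
      forall n, drop_last (f n.+1) = f n
    & exists d, forall n, (msize (f n) <= d)%N] >].

Lemma symfun_subalg_closed : subalg_closed symfun_pred.
Proof.
split=> [|a f g|f g].
- apply/asboolP; split=> [n|n|]; [exact: rpred1 | exact: comp_mpoly1 |].
  by exists 1%N => n; rewrite msize1.
- move=> /asboolP [fs fr [df fd]] /asboolP [gs gr [dg gd]]; apply/asboolP.
  have E n : (a *: f + g) n = a *: f n + g n by [].
  split=> [n|n|]; rewrite ?E.
  + exact: (rpredD (rpredZ a (fs n)) (gs n)).

  + by rewrite /drop_last comp_mpolyD comp_mpolyZ -!/(drop_last _) fr gr.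
  exists (maxn df dg) => n; rewrite E; apply: leq_trans (msizeD_le _ _) _.
  rewrite geq_max !leq_max (leq_trans (msizeZ_le _ _) (fd n)) /=.
  by rewrite gd orbT.
- move=> /asboolP [fs fr [df fd]] /asboolP [gs gr [dg gd]]; apply/asboolP.
  have E n : (f * g) n = f n * g n by [].
  split=> [n|n|]; rewrite ?E.
  + exact: (rpredM (fs n) (gs n)).
  + by rewrite /drop_last rmorphM /= -!/(drop_last _) fr gr.
  exists (df + dg)%N => n; rewrite E.
  have [->|f0] := eqVneq (f n) 0; first by rewrite mul0r msize0.
  have [->|g0] := eqVneq (g n) 0; first by rewrite mulr0 msize0.
  by rewrite msizeM //; apply: leq_trans (leq_pred _) _; exact: leq_add.
Qed.

HB.instance Definition _ :=
  GRing.isSubalgClosed.Build rat mpolyseq symfun_pred symfun_subalg_closed.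

Record symfun := SymFun { symfun_val : mpolyseq; _ : symfun_val \in symfun_pred }.
HB.instance Definition _ := [isSub for symfun_val].
HB.instance Definition _ := [Choice of symfun by <:].
HB.instance Definition _ := [SubChoice_isSubAlgebra of symfun by <:].
HB.instance Definition _ := [SubNzRing_isSubComNzRing of symfun by <:].

(* The Schur function S_la, as its sequence of specialisations to finitely many
   variables.  It is symmetric, so it belongs to symfun_pred, but the definitions
   below, being equalities in mpolyseq, do not depend on a proof of this. *)
Definition schur (la : intpart) : mpolyseq := fun n => schur_poly n la.

Definition doubly_symmetric : {pred symfun} := fun f => `[<
  exists2 m : {fsfun intpart -> rat with 0},
    symfun_val f = \sum_(la <- finsupp m) m la *: schur la
  & forall k l, \sum_(la <- finsupp m) m la *: schur_poly (k + l) la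
              = \sum_(la <- finsupp m) m la *: hook_schur k l la >].

(* A copy of P indexed by the closure proof, so that ring instances can be
   attached to it. *)
Definition subring_pred (R : comNzRingType) (P : {pred R})
  of subring_closed P : {pred R} := P.
HB.instance Definition _ (R : comNzRingType) (P : {pred R})
    (hP : subring_closed P) :=
  GRing.isSubringClosed.Build R (subring_pred hP) hP.

Record subring_of (R : comNzRingType) (P : {pred R}) (hP : subring_closed P) :=
  SubringOf { subring_val :> R; _ : subring_val \in subring_pred hP }.
HB.instance Definition _ (R : comNzRingType) (P : {pred R})
  (hP : subring_closed P) := [isSub for @subring_val R P hP].
HB.instance Definition _ (R : comNzRingType) (P : {pred R})
  (hP : subring_closed P) := [Choice of subring_of hP by <:].
HB.instance Definition _ (R : comNzRingType) (P : {pred R})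
  (hP : subring_closed P) := [SubChoice_isSubComNzRing of subring_of hP by <:].

Definition conj_ideal : {pred symfun} := fun f => `[<
  exists s : seq (symfun * intpart), symfun_val f =
    \sum_(p <- s) symfun_val p.1 * (schur p.2 - schur (conj_part p.2)) >].

Lemma is_part_head r s : is_part (r :: s) -> (0 < r)%N.
Proof. by case/andP=> _; rewrite inE negb_or lt0n eq_sym; case/andP. Qed.

Lemma schur_poly0 (la : intpart) : (0 < size la)%N -> schur_poly 0 la = 0.
Proof.
move=> la0; rewrite /schur_poly; apply: big1 => T _; exfalso.
have r0 : (0 < nth 0%N la 0)%N.
  by case: la la0 {T} => -[|r s] //= Hla _; apply: is_part_head Hla.
pose b : box la :=
  Tagged (fun i : 'I_(size la) => 'I_(nth 0%N la i)) (i := Ordinal la0) (Ordinal r0).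
by case: (T b).
Qed.

Lemma schur_conj0 (la : intpart) :
  schur_poly 0 la = schur_poly 0 (conj_part la).
Proof.
have [la0|la0] := posnP (size la).
  by congr schur_poly; apply: val_inj => /=; move/size0nil: la0 => ->.
rewrite !schur_poly0 //= size_map size_iota.
by case: la la0 => -[|r s] //= Hla _; apply: is_part_head Hla.
Qed.

Lemma conj_ideal_closed : idealr_closed conj_ideal.
Proof.
split=> [||a f g].
- by apply/asboolP; exists [::]; rewrite big_nil.
- apply/negP => /asboolP [s] /(congr1 (fun h : mpolyseq => h 0%N)).
  have mor : {morph (fun h : mpolyseq => h 0%N) : x y / x + y} by [].
  rewrite (big_morph _ mor (erefl : (0 : mpolyseq) 0%N = 0)) big1.
    by move/eqP; rewrite oner_eq0.
  move=> p _; transitivity (symfun_val p.1 0%N *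
    (schur_poly 0 p.2 - schur_poly 0 (conj_part p.2))); first by [].
  by rewrite -schur_conj0 subrr mulr0.
- move=> /asboolP [s fE] /asboolP [t gE]; apply/asboolP.
  exists ([seq (a * p.1, p.2) | p <- s] ++ t).
  rewrite big_cat big_map -gE /=.
  transitivity (symfun_val a * symfun_val f + symfun_val g); first by [].
  rewrite fE mulr_sumr; congr (_ + _); apply: eq_bigr => p _.
  by rewrite mulrA.
Qed.

HB.instance Definition _ := isIdealr.Build symfun conj_ideal conj_ideal_closed.

(* Main.v *)
From HB Require Import structures.
Require Import Defs.
From mathcomp Require Import all_boot all_order all_algebra ring_quotient.
From mathcomp Require Import fingroup perm finmap mpoly boolp zify.

(* Superizing the alphabet (X;Y) replaces E(t) = prod (1 + xt) by the series
   prod (1 + xt) / prod (1 - yt).  The Jacobi-Trudi determinant, proved by adding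
   letters one at a time, is uniform in which letters are primed; hence hook
   Schur functions are the images of the Schur functions under a ring map out of
   Q[e_1, e_2, ...], and transposing diagrams exchanges primed and unprimed
   letters.  So f is doubly symmetric iff all these ring maps agree with the plain
   specialisations, and in particular D is a subring.
   - S = D + I: the coefficients of H(t)E(t) lie in D, and modulo I, where
     H = E, they are those of E(t)^2, from which e_r is recovered recursively.
   - D meets I in 0: superizing at Y = X makes H = E, so it kills I; on D it is
     f |-> f(X, X), i.e. E |-> E^2, which is injective because power series with
     constant term 1 have square roots. *)

Set Implicit Arguments.
Unset Strict Implicit.
Unset Printing Implicit Defensive.

Import GRing.Theory.
Local Open Scope ring_scope.

(** * The Jacobi-Trudi determinant, one letter at a time *)

(** The tableau sum and the determinant obey the same recursion: the largest letter fills a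
    horizontal strip if unprimed and a vertical strip if primed, and row operations cut the rows of
    the determinant down to the terms allowed by that strip. In the vertical case the strip
    condition also admits sequences that are not partitions; they carry no tableau, and their
    determinant has two equal rows. Double symmetry is defined through an expansion in Schur
    functions; the ring maps turn it into a property of the function alone. A symmetric function is
    here a coherent sequence of polynomials of bounded degree, so it is a polynomial in e_1, ...,
    e_d only once d is large. The ring maps are therefore truncated at d, and they are compared with
    specialisations for large d only. As they are given by the images of the e_r, that is by the
    series E and not H, primed and unprimed letters appear exchanged in them ([negb \o s]). Rational
    coefficients matter through division by 2, both in recovering e_r and in the square root. *)

Section Conv.
Variable R : comNzRingType.
Implicit Types (f g h : nat -> R) (x : nat -> R) (s : nat -> bool).

Definition conv f g : nat -> R := fun r => \sum_(i < r.+1) f i * g (r - i)%N.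
Definition conv1 : nat -> R := fun r => (r == 0%N)%:R.

(** Truncating below degree N turns convolution into a product of polynomials, from which
    commutativity and associativity are inherited. *)
Lemma conv_poly f g N r : (r < N)%N ->
  conv f g r = ((\poly_(i < N) f i) * (\poly_(i < N) g i))`_r.
Proof.
move=> rN; rewrite coefM; apply: eq_bigr => i _; rewrite !coef_poly.
have -> : (i < N)%N by apply: leq_trans rN; apply: ltn_ord.
by rewrite (leq_ltn_trans (leq_subr _ _) rN).
Qed.

Lemma convC : commutative conv.
Proof.
by move=> f g; apply/funext => r; rewrite !(@conv_poly _ _ r.+1) // mulrC.
Qed.

Lemma convA : associative conv.
Proof.
move=> f g h; apply/funext => r.
have E f1 f2 f3 : conv (conv f1 f2) f3 r =
    ((\poly_(i < r.+1) f1 i) * (\poly_(i < r.+1) f2 i) * (\poly_(i < r.+1) f3 i))`_r.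
  rewrite coefM; apply: eq_bigr => i _; rewrite -conv_poly // coef_poly.
  by rewrite ltnS leq_subr.
by rewrite convC !E mulrC mulrA.
Qed.

Lemma conv1f : left_id conv1 conv.
Proof.
move=> f; apply/funext => r; rewrite /conv big_ord_recl /= /conv1 eqxx mul1r subn0.
by rewrite big1 ?addr0 // => i _; rewrite mul0r.
Qed.

HB.instance Definition _ := Monoid.isComLaw.Build (nat -> R) conv1 conv convA convC conv1f.

(* The h-series 1 + tz or 1 / (1 - tz) of one letter, according to whether it is
   primed (b = true). *)
Definition letter (b : bool) (t : R) : nat -> R :=
  fun r => if b && (1 < r)%N then 0 else t ^+ r.

Definition super_h x s n : nat -> R := \big[conv/conv1]_(i < n) letter (s i) (x i).

Lemma super_h0 x s : super_h x s 0 = conv1. Proof. by rewrite /super_h big_ord0. Qed.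

Lemma super_hS x s n : super_h x s n.+1 = conv (super_h x s n) (letter (s n) (x n)).
Proof. by rewrite /super_h big_ord_recr. Qed.

Lemma super_h_0 x s n : super_h x s n 0%N = 1.
Proof.
elim: n => [|n IH]; first by rewrite super_h0.
by rewrite super_hS /conv big_ord1 IH mul1r /letter andbF.
Qed.

(** The Jacobi-Trudi determinant with rows and columns both reversed, so that [kap] increases. The
    test enforces the convention that negative indices give 0, which truncated subtraction would
    break. *)
Definition jt (a : nat -> R) (L : nat) (kap : 'I_L -> nat) : R :=
  \det (\matrix_(i < L, j < L)
    if (j <= kap i + i)%N then a (kap i + i - j)%N else 0).

Definition jt_entry (a : nat -> R) (b j : nat) : R := if (j <= b)%N then a (b - j)%N else 0.

Lemma jtE a L (kap : 'I_L -> nat) :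
  jt a kap = \det (\matrix_(i < L, j < L) jt_entry a (kap i + i) j).
Proof. by []. Qed.

(** An entry depends on its row only through b, so convolving with [f] replaces a row by a
    combination of the rows c <= b. *)
Lemma jt_entry_conv a f b j :
  jt_entry (conv a f) b j = \sum_(0 <= c < b.+1) f (b - c)%N * jt_entry a c j.
Proof.
rewrite {1}/jt_entry; case: leqP => jb; last first.
  rewrite big_nat big1 // => c /andP [_ cb].
  by rewrite /jt_entry leqNgt (leq_ltn_trans _ jb) // mulr0.
rewrite (@big_cat_nat _ _ _ j) //=; last exact: leqW.
rewrite [X in X + _]big_nat [X in X + _]big1 ?add0r; last first.
  by move=> c /andP [_ cj]; rewrite /jt_entry leqNgt cj mulr0.
rewrite -{2}(add0n j) big_addn subSn // big_mkord; apply: eq_bigr => i _.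
by rewrite /jt_entry leq_addl addnK mulrC subnDA subnAC.
Qed.

Definition prev_ord L (i : 'I_L) : 'I_L :=
  Ordinal (leq_ltn_trans (leq_pred i) (ltn_ord i)).

(** The hypothesis says that A = U C with U lower unitriangular. *)
Lemma det_bidiag L (A C : 'M[R]_L) (u : 'I_L -> R) :
  (forall i j, A i j = C i j + (if i == 0%N :> nat then 0 else u i * C (prev_ord i) j)) ->
  \det A = \det C.
Proof.
move=> AC.
pose v (i : 'I_L) : R := if i == 0%N :> nat then 0 else u i.
pose U : 'M[R]_L := \matrix_(i < L, k < L) ((i == k)%:R + (k == prev_ord i)%:R * v i).
have -> : A = U *m C.
  apply/matrixP => i j; rewrite mxE AC.
  under eq_bigr => k _ do rewrite mxE mulrDl.
  rewrite big_split /= (bigD1 i) //= eqxx mul1r big1 ?addr0; last first.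
    by move=> k ki; rewrite eq_sym (negbTE ki) mul0r.
  congr (_ + _); rewrite (bigD1 (prev_ord i)) //= eqxx mul1r big1 ?addr0; last first.
    by move=> k ki; rewrite (negbTE ki) !mul0r.
  by rewrite /v; case: ifP; rewrite ?mul0r.
rewrite det_mulmx det_trig ?big1 ?mul1r //.
  move=> i _; rewrite mxE eqxx /v.
  case: ifP => [|i0]; first by rewrite mulr0 addr0.
  rewrite -val_eqE /=; have -> : (i == i.-1 :> nat) = false by move: i0; lia.
  by rewrite mul0r addr0.
apply/is_trig_mxP => i j ij; rewrite mxE -!val_eqE /=.
have -> : (i == j :> nat) = false by lia.
have -> : (j == i.-1 :> nat) = false by lia.
by rewrite mul0r addr0.
Qed.

(** Multilinearity in the rows, the range of summation being allowed to vary with the row. *)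
Lemma det_rows_sum L K (c : 'I_L -> 'I_K -> R) (B : 'I_L -> 'I_K -> 'I_L -> R)
    (P : 'I_L -> pred 'I_K) :
  \det (\matrix_(i, j) \sum_(b | P i b) c i b * B i b j) =
  \sum_(f in family P) (\prod_i c i (f i)) * \det (\matrix_(i, j) B i (f i) j).
Proof.
rewrite {1}/determinant.
under eq_bigr => s _.
  under eq_bigr => i _ do rewrite mxE.
  rewrite (bigA_distr_big_dep (fun i => P i)) mulr_sumr; over.
rewrite exchange_big /=; apply: eq_bigr => f _.
rewrite /determinant mulr_sumr; apply: eq_bigr => s _.
rewrite big_split /= mulrCA; congr (_ * (_ * _)).
by apply: eq_bigr => i _; rewrite mxE.
Qed.

Definition strip_lo (b : bool) L (kap : 'I_L -> nat) (i : 'I_L) : nat :=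
  if b then (kap i).-1 else if i == 0%N :> nat then 0 else kap (prev_ord i).

Definition weakly_incr L (kap : 'I_L -> nat) := forall i j : 'I_L, (i <= j)%N -> (kap i <= kap j)%N.

(** Vertical strips for [b = true], horizontal ones otherwise; row [prev_ord i] lies below row i.
    Nothing forces [nu] to be increasing when [b = true]. *)
Definition strip (b : bool) L M (kap : 'I_L -> nat) : {pred {ffun 'I_L -> 'I_M.+1}} :=
  family (fun i => [pred v : 'I_M.+1 | (strip_lo b kap i <= v <= kap i)%N]).

Lemma stripP b L M (kap : 'I_L -> nat) (nu : {ffun 'I_L -> 'I_M.+1}) :
  reflect (forall i : 'I_L, (strip_lo b kap i <= nu i)%N /\ (nu i <= kap i)%N) (nu \in strip b kap).
Proof. by apply: (iffP familyP) => H i; apply/andP; have := H i. Qed.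

(** By multilinearity the right-hand side is a single determinant, whose rows are the sums of
    [jt_entry_conv] cut down to the strip. Cut and full rows differ by a multiple of the preceding
    row. *)
Lemma jt_step x s n L M (kap : 'I_L -> nat) :
    weakly_incr kap -> (forall i, (kap i <= M)%N) ->
  jt (super_h x s n.+1) kap = \sum_(nu in @strip (s n) L M kap)
      (\prod_i x n ^+ (kap i - nu i)) * jt (super_h x s n) (fun i => nu i : nat).
Proof.
move=> mk kM.
rewrite -(det_rows_sum (fun i (v : 'I_M.+1) => x n ^+ (kap i - v))
  (fun i (v : 'I_M.+1) (j : 'I_L) => jt_entry (super_h x s n) (v + i) j)).
have E i (j : 'I_L) :
  \sum_(v < M.+1 | (strip_lo (s n) kap i <= v <= kap i)%N)
      x n ^+ (kap i - v) * jt_entry (super_h x s n) (v + i) j =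
  \sum_(strip_lo (s n) kap i + i <= c < (kap i + i).+1)
      x n ^+ (kap i + i - c) * jt_entry (super_h x s n) c j.
  rewrite -addSn big_addn addnK.
  rewrite [RHS](@big_nat_widen _ _ _ _ _ M.+1); last by rewrite ltnS kM.
  rewrite big_geq_mkord.
  apply: eq_big => [v|v _]; first by rewrite /= ltnS andbC.
  by rewrite subnDr.
rewrite jtE super_hS.
case sn: (s n) E => E; last first.
  (* The discarded terms c < kap_(i-1) + i form a geometric tail: they make up x_n^(kap_i -
     kap_(i-1) + 1) times the full row i - 1. *)
  symmetry; apply: (@det_bidiag _ _ _ (fun i => - x n ^+ (kap i - kap (prev_ord i)).+1)).
  move=> i j; rewrite !mxE E !jt_entry_conv /strip_lo.
  case: ifP => i0.
    by rewrite addr0 (eqP i0).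
  rewrite (@big_cat_nat _ _ _ (kap (prev_ord i) + i) 0) //=; last first.
    by rewrite leqW // leq_add2r; apply: mk; apply: leq_pred.
  have -> : (kap (prev_ord i) + i.-1).+1 = (kap (prev_ord i) + i)%N by move: i0; lia.
  rewrite addrAC mulr_sumr -big_split /=.
  rewrite [X in _ = X + _]big_nat [X in _ = X + _]big1 ?add0r // => c /andP [_ ci].
  rewrite /letter /= mulrA mulNr -exprD.
  have := mk (prev_ord i) i (leq_pred i).
  move: i0 ci => /= i0 ci kk.
  have -> : ((kap i - kap (prev_ord i)).+1 + (kap (prev_ord i) + i.-1 - c) =
     kap i + i - c)%N by move: i0 ci kk; set q := kap (prev_ord i); lia.
  by rewrite mulNr addrN.
(* A primed letter has a two-term series, so a row is already cut unless kap_i = 0. For i > 0 the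
   extra term is then x_n times the cut row i - 1, where kap vanishes too. *)
apply: (@det_bidiag _ _ _ (fun i => if kap i == 0%N then x n else 0)) => i j.
rewrite !mxE !E jt_entry_conv /strip_lo.
have [k0|k0] := eqVneq (kap i) 0%N; last first.
  rewrite mul0r if_same addr0 (@big_cat_nat _ _ _ ((kap i).-1 + i)%N) //=; last lia.
  rewrite [X in X + _]big_nat [X in X + _]big1 ?add0r; last first.
    move=> c /andP [_ ci]; rewrite /letter /=.
    have -> : (1 < kap i + i - c)%N by lia.
    by rewrite mul0r.
  rewrite !big_nat; apply: eq_bigr => c /andP [ci1 ci2]; congr (_ * _).
  by rewrite /letter; have -> : (1 < kap i + i - c)%N = false by lia.
rewrite k0 /= add0n big_nat1 subnn expr0 mul1r.
rewrite big_nat_recr //= subnn /letter /= expr0 mul1r addrC; congr (_ + _).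
case: ifP => i0; first by rewrite (eqP i0) big_geq.
have ki0 : kap (prev_ord i) = 0%N.
  by apply/eqP; rewrite -leqn0 -k0; apply: mk; apply: leq_pred.
rewrite ki0 /= add0n big_nat1 subnn expr0 mul1r.
case: (val i) i0 => // m _ /=.
rewrite big_nat_recr //= subSnn expr1 big_nat big1 ?add0r // => c /andP [_ cm].
have -> : (1 < m.+1 - c)%N by lia.
by rewrite mul0r.
Qed.

(** A nonzero part makes the last, largest one nonzero; all indices in the last row are then
    positive, where [conv1] vanishes. *)
Lemma jt_conv1 L (kap : 'I_L -> nat) : weakly_incr kap ->
  jt conv1 kap = [forall i, kap i == 0%N]%:R.
Proof.
move=> mk; case: forallP => [k0|].
  rewrite jtE (_ : \matrix_(i, j) _ = 1%:M) ?det1 //.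
  apply/matrixP => i j; rewrite !mxE (eqP (k0 i)) add0n /jt_entry /conv1 -val_eqE /=.
  case: leqP => ij; last by have -> : (i == j :> nat) = false by lia.
  by congr (nat_of_bool _)%:R; apply/eqP/eqP; lia.
move=> /forallP; rewrite negb_forall => /existsP [i ki].
case: L kap mk i ki => [|L] kap mk i ki; first by case: i {ki}.
rewrite jtE (expand_det_row _ ord_max) big1 // => j _; rewrite mxE /jt_entry /conv1.
have := mk i ord_max (ltn_ord i); have := ltn_ord j; move: ki => /= ki jL km.
case: ifP => _; last by rewrite mul0r.
have -> : (kap ord_max + L - j == 0)%N = false by lia.
by rewrite mul0r.
Qed.

Lemma jt_eq0 (a : nat -> R) L (kap : 'I_L -> nat) (i j : 'I_L) : (i < j)%N ->
  (kap i + i = kap j + j)%N -> jt a kap = 0.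
Proof.
move=> ij e; rewrite jtE (determinant_alternate (_ : i != j)) //.
  by rewrite -val_eqE /=; lia.
by move=> k; rewrite !mxE e.
Qed.

End Conv.

(** * Tableaux on an alphabet of primed and unprimed letters *)

Lemma card_ord_ltn M v : (v <= M)%N -> #|[set j : 'I_M | (j < v)%N]| = v.
Proof.
move=> vM; rewrite cardsE -sum1_card.
by rewrite -(big_ord_widen _ (fun=> 1%N) vM) sum1_card card_ord.
Qed.

Lemma weakly_incr_prev L (kap : 'I_L -> nat) :
  (forall i : 'I_L, i != 0%N :> nat -> (kap (prev_ord i) <= kap i)%N) -> weakly_incr kap.
Proof.
move=> H i [j jL] /= ij.
elim: j jL ij => [|j IH] jL ij.
  by have -> : i = Ordinal jL by apply/val_inj; move: ij => /=; lia.
have [->|ne] := eqVneq i (Ordinal jL); first by [].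
have jL' : (j < L)%N by lia.
have ij' : (i <= j)%N by move: ne ij; rewrite -val_eqE /=; lia.
apply: leq_trans (IH jL' ij') _.
have -> : Ordinal jL' = prev_ord (Ordinal jL) by apply/val_inj.
exact: H.
Qed.

Section Grid.
Variables (R : comNzRingType) (x : nat -> R) (s : nat -> bool) (L M N : nat).
Notation filling := {ffun 'I_L * 'I_M -> 'I_N.+1}.
Implicit Types (T : filling) (kap : 'I_L -> nat).

(* Rows are numbered from the last one, so that their lengths kap increase;
   the value N marks the cells outside the shape. *)
Definition row_ok (a b : nat) := (a <= b)%N && ((a == b) ==> (a == N) || ~~ s a).
Definition col_ok (a b : nat) := (a <= b)%N && ((a == b) ==> (a == N) || s a).

Definition grid_tab n kap T :=
  [&& [forall p : 'I_L * 'I_M, if (p.2 < kap p.1)%N then (T p < n)%N else T p == N :> nat],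
      [forall i : 'I_L, forall j : 'I_M, forall j' : 'I_M,
         (j < j')%N ==> row_ok (T (i, j)) (T (i, j'))]
    & [forall i : 'I_L, forall i' : 'I_L, forall j : 'I_M,
         (i < i')%N ==> col_ok (T (i', j)) (T (i, j))]].

Lemma grid_tabP n kap T : reflect
  [/\ forall (i : 'I_L) (j : 'I_M),
        if (j < kap i)%N then (T (i, j) < n)%N else T (i, j) == N :> nat,
      forall (i : 'I_L) (j j' : 'I_M), (j < j')%N -> row_ok (T (i, j)) (T (i, j'))
    & forall (i i' : 'I_L) (j : 'I_M), (i < i')%N -> col_ok (T (i', j)) (T (i, j))]
  (grid_tab n kap T).
Proof.
apply: (iffP and3P) => -[H1 H2 H3]; split.
- by move=> i j; have /forallP /(_ (i, j)) := H1.
- move=> i j j' jj.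
  by have /forallP /(_ i) /forallP /(_ j) /forallP /(_ j') := H2; rewrite jj.
- move=> i i' j ii.
  by have /forallP /(_ i) /forallP /(_ i') /forallP /(_ j) := H3; rewrite ii.
- by apply/forallP => -[i j]; apply: H1.
- by apply/forallP => i; apply/forallP => j; apply/forallP => j'; apply/implyP; apply: H2.
- by apply/forallP => i; apply/forallP => j; apply/forallP => j'; apply/implyP; apply: H3.
Qed.

Definition cell_weight (a : nat) : R := if (a < N)%N then x a else 1.
Definition grid_sum n kap : R := \sum_(T | grid_tab n kap T) \prod_p cell_weight (T p).

Definition lower_shape n T : {ffun 'I_L -> 'I_M.+1} :=
  [ffun i => inord #|[set j | (T (i, j) < n)%N]|].

Lemma lower_shape_eq n T (nu : {ffun 'I_L -> 'I_M.+1}) :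
  (forall (i : 'I_L) (j : 'I_M), (T (i, j) < n)%N = (j < nu i)%N) -> lower_shape n T = nu.
Proof.
move=> H; apply/ffunP => i; apply/val_inj; rewrite ffunE /=.
have -> : [set j | (T (i, j) < n)%N] = [set j : 'I_M | (j < nu i)%N].
  by apply/setP => j; rewrite !inE H.
by rewrite card_ord_ltn ?inord_val // -ltnS.
Qed.

(** Rows increase weakly, so the entries below n form an initial segment, determined by its
    length. *)
Lemma lower_shapeP n T (i : 'I_L) (j : 'I_M) :
  (forall (i : 'I_L) (j j' : 'I_M), (j < j')%N -> (T (i, j) <= T (i, j'))%N) ->
  (T (i, j) < n)%N = (j < lower_shape n T i)%N.
Proof.
move=> H; rewrite ffunE inordK ?ltnS; last by rewrite -[M in (_ <= M)%N]card_ord max_card.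
set S := [set _ | _].
apply/idP/idP => [Tn|].
  rewrite -(card_ord_ltn (ltn_ord j)); apply/subset_leq_card/subsetP => j'.
  rewrite !inE ltnS leq_eqVlt => /orP [/eqP/val_inj -> //|/(H i)].
  by move/leq_ltn_trans; apply.
apply: contraLR; rewrite -leqNgt -leqNgt => nT.
rewrite -[leqRHS](card_ord_ltn (ltnW (ltn_ord j))); apply/subset_leq_card/subsetP => j'.
rewrite !inE ltnNge => Tj; rewrite ltnNge; apply/negP => jj.
move/negP: Tj; apply; apply: (leq_trans nT).
by move: jj; rewrite leq_eqVlt => /orP [/eqP/val_inj -> //|/(H i)].
Qed.

Definition remove_letter n T : filling := [ffun p => if (T p < n)%N then T p else ord_max].
Definition add_letter n kap T : filling :=
  [ffun p => if (T p < n)%N then T p else if (p.2 < kap p.1)%N then inord n else ord_max].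

Section Step.
Variables (n : nat) (kap : 'I_L -> nat).
Hypotheses (nN : (n < N)%N) (mk : weakly_incr kap) (kM : forall i, (kap i <= M)%N).

(** If the lower bound failed, two adjacent boxes would both contain n, in a row for a primed letter
    or in a column for an unprimed one. *)
Lemma grid_tab_strip T (nu : {ffun 'I_L -> 'I_M.+1}) : grid_tab n.+1 kap T ->
  (forall (i : 'I_L) (j : 'I_M), (T (i, j) < n)%N = (j < nu i)%N) -> nu \in @strip (s n) L M kap.
Proof.
move=> /grid_tabP [G1 G2 G3] H; apply/stripP => i; split; last first.
  rewrite leqNgt; apply/negP => kn.
  have jM : (kap i < M)%N by apply: leq_trans kn _; rewrite -ltnS.
  have := G1 i (Ordinal jM); have := H i (Ordinal jM); rewrite /= kn ltnn.
  by move=> Tn /eqP TN; move: Tn; rewrite TN; lia.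
rewrite /strip_lo; case sn: (s n).
  rewrite leqNgt; apply/negP => kn.
  have jM : ((nu i).+1 < M)%N by have := kM i; lia.
  have jM' : (nu i < M)%N by lia.
  have := G1 i (Ordinal jM); have := H i (Ordinal jM).
  have := G1 i (Ordinal jM'); have := H i (Ordinal jM').
  have := G2 i (Ordinal jM') (Ordinal jM) (ltnSn _).
  rewrite /= ltnn.
  have -> : ((nu i).+1 < nu i)%N = false by lia.
  have -> : (nu i < kap i)%N by lia.
  have -> : ((nu i).+1 < kap i)%N by lia.
  rewrite !ltnS => + t1 t2 t3 t4.
  have e1 : T (i, Ordinal jM') = n :> nat by lia.
  have e2 : T (i, Ordinal jM) = n :> nat by lia.
  by rewrite /row_ok e1 e2 eqxx sn leqnn /= orbF; lia.
case: ifP => // i0; rewrite leqNgt; apply/negP => kn.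
have jM : (nu i < M)%N by have := kM (prev_ord i); lia.
have ki := mk (leq_pred i : (prev_ord i <= i)%N).
have := G1 i (Ordinal jM); have := H i (Ordinal jM).
have := G1 (prev_ord i) (Ordinal jM).
have := G3 (prev_ord i) i (Ordinal jM) _; rewrite /= ltnn kn (leq_trans kn ki).
have -> : (i.-1 < i)%N by lia.
move=> /(_ isT) + t1 t2 t3.
move=> h; move: (h) => /andP [h1 _].
have e1 : T (i, Ordinal jM) = n :> nat by lia.
have e2 : T (prev_ord i, Ordinal jM) = n :> nat by lia.
by move: h; rewrite /col_ok e1 e2 eqxx sn leqnn /= orbF; lia.
Qed.

Lemma grid_tab_remove T (nu : {ffun 'I_L -> 'I_M.+1}) : grid_tab n.+1 kap T ->
  (forall (i : 'I_L) (j : 'I_M), (T (i, j) < n)%N = (j < nu i)%N) ->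
  grid_tab n (fun i => nu i) (remove_letter n T).
Proof.
move=> /grid_tabP [G1 G2 G3] H; apply/grid_tabP; split.
- by move=> i j; rewrite ffunE -H; case: ifP => [Tn|->] //=; rewrite Tn.
- move=> i j j' jj; have := G2 i j j' jj; rewrite !ffunE /row_ok.
  have := ltn_ord (T (i, j)); have := ltn_ord (T (i, j')).
  by case: ifP; case: ifP => //=; rewrite ?leqnn ?eqxx //=; lia.
- move=> i i' j jj; have := G3 i i' j jj; rewrite !ffunE /col_ok.
  have := ltn_ord (T (i, j)); have := ltn_ord (T (i', j)).
  by case: ifP; case: ifP => //=; rewrite ?leqnn ?eqxx //=; lia.
Qed.

Lemma grid_tab_lt m (nu : 'I_L -> nat) T (i : 'I_L) (j : 'I_M) : (m <= N)%N ->
  grid_tab m nu T -> (T (i, j) < m)%N = (j < nu i)%N.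
Proof.
move=> mN /grid_tabP [G1 _ _]; have := G1 i j; case: ifP => // _ /eqP ->.
by rewrite ltnNge mN.
Qed.

Lemma grid_tab_add T (nu : {ffun 'I_L -> 'I_M.+1}) : nu \in @strip (s n) L M kap ->
  grid_tab n (fun i => nu i) T -> grid_tab n.+1 kap (add_letter n kap T).
Proof.
move=> /stripP st gT; have H i j := grid_tab_lt i j (ltnW nN) gT.
have [G1 G2 G3] := grid_tabP _ _ _ gT.
have nk (i : 'I_L) : (nu i <= kap i)%N by have [] := st i.
have inn : (inord n : 'I_N.+1) = n :> nat by rewrite inordK // leqW.
apply/grid_tabP; split.
- move=> i j; rewrite ffunE H /=; have := nk i.
  case: (ltnP j (nu i)) => jn ni.
    by rewrite (leq_trans jn ni) ltnS ltnW // H.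
  by case: ifP => -> /=; rewrite ?inn ?ltnSn ?eqxx.
- move=> i j j' jj; have := G2 i j j' jj; rewrite !ffunE /= /row_ok.
  have := H i j; have := H i j'; have := nk i; have := st i; rewrite /strip_lo.
  have := ltn_ord (T (i, j)); have := ltn_ord (T (i, j')).
  case: (ltnP j (nu i)) => jn; case: (ltnP j' (nu i)) => jn' //=;
    move=> T1 T2 [st1 _] st2 h1 h2; rewrite h1 h2 //=.
  + case: (ltnP j' (kap i)) => jk /=; rewrite ?inn; lia.
  + lia.
  + case: (ltnP j (kap i)) => jk; case: (ltnP j' (kap i)) => jk' /=; rewrite ?inn; try lia.
    move: st1; case sn: (s n); rewrite eqxx leqnn ?orbT //=; lia.
- move=> i i' j jj; have := G3 i i' j jj; rewrite !ffunE /= /col_ok.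
  have := H i j; have := H i' j; have := nk i; have := nk i'; have := st i; have := st i'.
  rewrite /strip_lo.
  have k1 : (kap i <= kap (prev_ord i'))%N by apply: mk => /=; lia.
  have k2 : (kap i <= kap i')%N by apply: mk; lia.
  have -> : (i' == 0%N :> nat) = false by lia.
  have := ltn_ord (T (i, j)); have := ltn_ord (T (i', j)).
  case: (ltnP j (nu i)) => jn; case: (ltnP j (nu i')) => jn' //=;
    move=> T1 T2 [st0 _] [st1 _] st2 st3 h1 h2; rewrite h1 h2 //=; try lia.
  + case: (ltnP j (kap i)) => jk /=; rewrite ?inn; lia.
  + case: (ltnP j (kap i)) => jk; case: (ltnP j (kap i')) => jk' /=; rewrite ?inn; try lia.
Qed.

Lemma add_letterK T (nu : {ffun 'I_L -> 'I_M.+1}) :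
  grid_tab n (fun i => nu i) T -> remove_letter n (add_letter n kap T) = T.
Proof.
move=> gT; have [G1 _ _] := grid_tabP _ _ _ gT.
apply/ffunP => -[i j]; rewrite !ffunE /=; have := G1 i j.
case: (ltnP j (nu i)) => [_ Tn|jn /eqP TN].
  by rewrite Tn /= Tn.
have TF : (T (i, j) < n)%N = false by rewrite TN ltnNge ltnW.
rewrite TF /=; case: (j < kap i)%N.
  by rewrite inordK ?ltnn ?leqW //; apply/val_inj.
by rewrite ltnNge ltnW //; apply/val_inj.
Qed.

Lemma remove_letterK T : grid_tab n.+1 kap T -> add_letter n kap (remove_letter n T) = T.
Proof.
move=> gT; have [G1 _ _] := grid_tabP _ _ _ gT.
apply/ffunP => -[i j]; rewrite !ffunE /=.
case: (boolP (T (i, j) < n)%N) => Tn; first by rewrite /= Tn.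
rewrite /= ltnNge ltnW //=; have := G1 i j; case: ifP => [_ Tn1|_ /eqP TN]; apply/val_inj => //=.
rewrite inordK; last exact: leqW.
by apply/eqP; rewrite eqn_leq leqNgt Tn -ltnS Tn1.
Qed.

Lemma weight_add T (nu : {ffun 'I_L -> 'I_M.+1}) : nu \in @strip (s n) L M kap ->
    grid_tab n (fun i => nu i) T ->
  \prod_p cell_weight (add_letter n kap T p) =
  (\prod_i x n ^+ (kap i - nu i)) * \prod_p cell_weight (T p).
Proof.
move=> /stripP st gT; have H i j := grid_tab_lt i j (ltnW nN) gT.
have [G1 G2 G3] := grid_tabP _ _ _ gT.
have E F : \prod_p F p = \prod_i \prod_j F (i, j) :> R.
  by rewrite pair_bigA; apply: eq_bigr => -[].
rewrite !E -big_split; apply: eq_bigr => i _ /=.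
transitivity ((\prod_(j < M | (nu i <= j < kap i)%N) x n) * \prod_(j < M) cell_weight (T (i, j))).
  rewrite [X in _ = X * _]big_mkcond -big_split; apply: eq_bigr => j _ /=.
  rewrite !ffunE H /=; have := G1 i j.
  case: ltnP => jn; first by rewrite mul1r.
  move=> /eqP TN; rewrite {2}/cell_weight TN ltnn mulr1; case: ifP => _; last first.
    by rewrite /cell_weight /= ltnn.
  by rewrite /cell_weight inordK ?nN // leqW.
congr (_ * _).
have -> : \prod_(j < M | (nu i <= j < kap i)%N) x n = \prod_(nu i <= j < kap i) x n.
  rewrite [RHS](@big_nat_widen _ _ _ _ _ M) // big_geq_mkord.
  by apply: eq_bigl => j; rewrite andbC.
exact: prodr_const_nat.
Qed.

(** Tableaux are grouped by the shape of their letters below n; on each group, erasing and restoring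
    the letter n are mutually inverse. *)
Lemma grid_sum_step : grid_sum n.+1 kap = \sum_(nu in @strip (s n) L M kap)
  (\prod_i x n ^+ (kap i - nu i)) * grid_sum n (fun i => nu i).
Proof.
have shT T : grid_tab n.+1 kap T -> forall i j, (T (i, j) < n)%N = (j < lower_shape n T i)%N.
  move=> /grid_tabP [_ G2 _] i j; apply: lower_shapeP => i0 j0 j1 /(G2 i0) /andP [] //.
rewrite /grid_sum (partition_big (lower_shape n) [in @strip (s n) L M kap]); last first.
  by move=> T gT; apply: grid_tab_strip gT (shT _ gT).
apply: eq_bigr => nu nuS; rewrite big_distrr /=.
rewrite (reindex_onto (add_letter n kap) (remove_letter n)); last first.
  by move=> T /andP [gT _]; apply: remove_letterK.
apply: eq_big => [T|T /andP [/andP [gT /eqP sT] /eqP cT]].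
  apply/andP/idP => [[/andP [gT /eqP sT] /eqP <-]|gT].
    by apply: grid_tab_remove => // i j; rewrite (shT _ gT) sT.
  rewrite (grid_tab_add nuS gT) (add_letterK gT) eqxx; split=> //=; apply/eqP/lower_shape_eq => i j.
  rewrite -(grid_tab_lt _ _ _ gT); last exact: ltnW.
  rewrite !ffunE; case: ifP => //= Tn; case: ifP => _ /=; first by rewrite inordK ?ltnn // leqW.
  by rewrite ltnNge ltnW.
rewrite (weight_add nuS) // -cT; apply: grid_tab_remove => // i j.
by rewrite (shT _ gT) sT.
Qed.

End Step.

Lemma grid_sum_incr n nu : (n <= N)%N -> (forall i, (nu i <= M)%N) ->
  grid_sum n nu != 0 -> weakly_incr nu.
Proof.
move=> nN nM W0.
have [T gT] : exists T, grid_tab n nu T.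
  case: (boolP [exists T, grid_tab n nu T]) => [/existsP //|/existsPn H].
  by case/negP: W0; rewrite /grid_sum big1 // => T gT; have := H T; rewrite gT.
have [_ _ G3] := grid_tabP _ _ _ gT.
move=> i i'; rewrite leq_eqVlt => /orP [/eqP/val_inj -> //|ii].
rewrite leqNgt; apply/negP => nn.
have jM : (nu i' < M)%N by have := nM i; lia.
have /andP [le _] := G3 i i' (Ordinal jM) ii.
have := grid_tab_lt i (Ordinal jM) nN gT; have := grid_tab_lt i' (Ordinal jM) nN gT.
rewrite /= ltnn nn; lia.
Qed.

Lemma grid_sum_jt n kap : (n <= N)%N -> weakly_incr kap -> (forall i, (kap i <= M)%N) ->
  grid_sum n kap = jt (super_h x s n) kap.
Proof.
elim: n kap => [|n IH] kap nN mk kM.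
  rewrite super_h0 jt_conv1 //; case: (boolP [forall i, _]) => [/forallP k0|].
    rewrite /grid_sum (big_pred1 [ffun=> ord_max]).
      by rewrite big1 // => p _; rewrite ffunE /cell_weight ltnn.
    move=> T; apply/idP/eqP => [/grid_tabP [G1 _ _]|->].
      apply/ffunP => -[i j]; rewrite ffunE; apply/val_inj/eqP.
      by have := G1 i j; rewrite (eqP (k0 i)).
    apply/grid_tabP; split.
    + by move=> i j; rewrite ffunE (eqP (k0 i)) /= eqxx.
    + by move=> *; rewrite !ffunE /row_ok leqnn eqxx.
    + by move=> *; rewrite !ffunE /col_ok leqnn eqxx.
  rewrite negb_forall => /existsP [i ki]; rewrite /grid_sum big1 // => T /grid_tabP [G1 _ _].
  have jM : (0 < M)%N by have := kM i; lia.
  by have := G1 i (Ordinal jM); rewrite /= lt0n ki.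
rewrite (grid_sum_step nN mk kM) (jt_step _ _ _ mk kM); apply: eq_bigr => nu nuS.
congr (_ * _); case: (EM (weakly_incr (fun i => nu i : nat))) => mn.
  by apply: IH => // [|i]; [exact: ltnW | rewrite -ltnS].
have -> : grid_sum n (fun i => nu i) = 0.
  apply/eqP/negPn/negP => /grid_sum_incr => H; apply: mn; apply: H; first exact: ltnW.
  by move=> i; rewrite -ltnS.
(* A horizontal strip would force [nu] to increase, so the strip is vertical; then nu_(i-1) = nu_i +
   1, and rows i - 1 and i of the determinant coincide. *)
have [i [i0 ni]] : exists i : 'I_L, i != 0%N :> nat /\ ~~ (nu (prev_ord i) <= nu i)%N.
  apply/not_existsP => H; apply: mn; apply: weakly_incr_prev => i i0.
  by apply/negPn/negP => ni; apply: (H i).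
symmetry; apply: (@jt_eq0 _ _ _ _ (prev_ord i) i) => /=; first lia.
have := stripP _ _ _ nuS i; have := stripP _ _ _ nuS (prev_ord i); rewrite /strip_lo.
have := mk _ _ (leq_pred i : prev_ord i <= i)%N.
rewrite (negbTE i0); move: ni i0.
move: (nu i : nat) (nu (prev_ord i) : nat) (kap i) (kap (prev_ord i)) (nat_of_ord i) => a b p q m.
by case: (s n) => ba m0 pq [_ bq] [ka _]; lia.
Qed.

End Grid.

Section Tableaux.
Variables (B : finType) (r c : B -> nat).

Definition super_tab n (s : nat -> bool) (T : {ffun B -> 'I_n}) : bool :=
  [forall b, forall b',
     ((r b == r b') && (c b < c b')%N ==> (T b <= T b')%N && ((T b == T b') ==> ~~ s (T b)))
  && ((c b == c b') && (r b < r b')%N ==> (T b <= T b')%N && ((T b == T b') ==> s (T b)))].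

Definition tab_sum (R : comNzRingType) (x : nat -> R) s n : R :=
  \sum_(T | @super_tab n s T) \prod_b x (T b).

(** The boxes form an arbitrary finite set with two coordinates, so that exchanging [r] and [c] also
    yields the transposed formula. *)
Theorem tab_sum_jt (R : comNzRingType) (x : nat -> R) s n L (kap : 'I_L -> nat) :
    weakly_incr kap ->
    (forall b b', r b = r b' -> c b = c b' -> b = b') ->
    (forall b, exists2 i : 'I_L, r b = (L - i.+1)%N & (c b < kap i)%N) ->
    (forall (i : 'I_L) j, (j < kap i)%N -> exists2 b, r b = (L - i.+1)%N & c b = j) ->
  tab_sum x s n = jt (super_h x s n) kap.
Proof.
move=> mk inj fw bw; pose M := \max_i kap i.
have kM i : (kap i <= M)%N by apply: leq_bigmax.
rewrite -(@grid_sum_jt R x s L M n n kap) //.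
have rL b : (r b < L)%N by have [i -> _] := fw b; have := ltn_ord i; lia.
have cM b : (c b < M)%N by have [i _ H] := fw b; apply: leq_trans H _.
pose pos b : 'I_L * 'I_M := (rev_ord (Ordinal (rL b)), Ordinal (cM b)).
have posk b : ((pos b).2 < kap (pos b).1)%N.
  have [i ri ci] := fw b; rewrite /=; suff -> : rev_ord (Ordinal (rL b)) = i by [].
  by apply/val_inj => /=; rewrite ri; have := ltn_ord i; lia.
have posb (p : 'I_L * 'I_M) : (p.2 < kap p.1)%N -> exists b, pos b = p.
  case: p => i j /= /bw [b rb cb]; exists b; congr pair; apply/val_inj => //=.
  by rewrite rb; have := ltn_ord i; lia.
have posI : injective pos.
  move=> b b' [e ec]; apply: inj => //.
  by have := rL b; have := rL b'; move: e; lia.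
pose G (T : {ffun B -> 'I_n}) : {ffun 'I_L * 'I_M -> 'I_n.+1} :=
  [ffun p => if [pick b | pos b == p] is Some b then widen_ord (leqnSn n) (T b) else ord_max].
have Gpos T b : G T (pos b) = widen_ord (leqnSn n) (T b).
  by rewrite ffunE; case: pickP => [b' /eqP /posI -> //|/(_ b)]; rewrite eqxx.
have Gout T (p : 'I_L * 'I_M) : ~~ (p.2 < kap p.1)%N -> G T p = ord_max.
  by move=> pk; rewrite ffunE; case: pickP => // b /eqP e; move: pk; rewrite -e posk.
have Ginj : injective G.
  move=> T T' e; apply/ffunP => b; apply/val_inj.
  by have := congr1 val (Gpos T b); rewrite e Gpos.
have Gval T (p : 'I_L * 'I_M) : (exists2 b, p = pos b & G T p = T b :> nat) \/
    (~~ (p.2 < kap p.1)%N /\ G T p = n :> nat).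
  case: (boolP (p.2 < kap p.1)%N) => [/posb [b <-]|pk]; last by right; rewrite Gout.
  by left; exists b; rewrite ?Gpos.
have grid_tabG T : grid_tab s n kap (G T) = super_tab s T.
  apply/grid_tabP/idP => [[G1 G2 G3]|tT].
    apply/forallP => b; apply/forallP => b'; apply/andP; split; apply/implyP => /andP [/eqP e lt].
      have := G2 (pos b).1 (pos b).2 (pos b').2 lt.
      have -> : ((pos b).1, (pos b').2) = pos b' by congr pair; apply/val_inj; rewrite /= e.
      rewrite -surjective_pairing !Gpos /row_ok /=.
      by have -> : (T b == n :> nat) = false by have := ltn_ord (T b); lia.
    have lt' : ((pos b').1 < (pos b).1)%N by have := rL b; have := rL b'; rewrite /=; lia.
    have := G3 (pos b').1 (pos b).1 (pos b).2 lt'.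
    have -> : ((pos b').1, (pos b).2) = pos b' by congr pair; apply/val_inj; rewrite /= e.
    rewrite -surjective_pairing !Gpos /col_ok /=.
    by have -> : (T b == n :> nat) = false by have := ltn_ord (T b); lia.
  have tabT b b' := andP (forallP (forallP tT b) b').
  split.
  - move=> i j; case: ifP => jk.
      by case: (Gval T (i, j)) => [[b _ ->]|[]] /=; [apply: ltn_ord | rewrite jk].
    by rewrite Gout //= jk.
  - move=> i j j' jj; rewrite /row_ok.
    case: (Gval T (i, j)) => [[b e ->]|[/= nk ->]].
      case: (Gval T (i, j')) => [[b' e' ->]|[_ ->]].
        have [+ _] := tabT b b'; case: e => ei ej; case: e' => ei' ej'.
        have -> : r b == r b'.
          have := congr1 val ei; rewrite ei' /= => er.
          by have := rL b; have := rL b'; move: er; lia.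
        have -> : (c b < c b')%N by move: jj; rewrite ej ej'.
        by case/andP => -> /=; rewrite -val_eqE; case: eqP => //= _ ->; rewrite orbT.
      by have := ltn_ord (T b); lia.
    rewrite Gout /= ?leqnn ?eqxx //; lia.
  - move=> i i' j ii; rewrite /col_ok.
    case: (Gval T (i', j)) => [[b e ->]|[/= nk ->]].
      case: (Gval T (i, j)) => [[b' e' ->]|[_ ->]].
        have [_ +] := tabT b b'; case: e => ei ej; case: e' => ei' ej'.
        have -> : c b == c b' by have := congr1 val ej; rewrite ej' /= => ->.
        have -> : (r b < r b')%N.
          by move: ii; rewrite ei ei' /=; have := rL b; have := rL b'; lia.
        by case/andP => -> /=; rewrite -val_eqE; case: eqP => //= _ ->; rewrite orbT.
      by have := ltn_ord (T b); lia.
    rewrite Gout /= ?leqnn ?eqxx //.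
    by have := mk _ _ (ltnW ii); lia.
rewrite /tab_sum /grid_sum.
transitivity (\sum_(T in G @: [set T | super_tab s T]) \prod_p cell_weight x n (T p)).
  rewrite big_imset /=; last by move=> ? ? _ _ /Ginj.
  apply: eq_big => [T|T _]; first by rewrite inE.
  rewrite (bigID [pred p : 'I_L * 'I_M | (p.2 < kap p.1)%N]) /= [X in _ * X]big1 ?mulr1; last first.
    by move=> p pk; rewrite Gout // /cell_weight ltnn.
  rewrite (eq_bigl (mem (pos @: setT))); last first.
    move=> p; apply/idP/imsetP => [/posb [b <-]|[b _ ->]]; last exact: posk.
    by exists b.
  rewrite big_imset /=; last by move=> ? ? _ _ /posI.
  by apply: eq_big => [b|b _]; rewrite ?inE // Gpos /cell_weight /= ltn_ord.
apply: eq_bigl => T; apply/imsetP/idP => [[T']|gT].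
  by rewrite inE -grid_tabG => gT ->.
have lt b : (T (pos b) < n)%N.
  have := posk b; case: (pos b) => i j /= jk.
  by rewrite (grid_tab_lt _ _ _ gT).
pose T' := [ffun b => Ordinal (lt b)].
have e : T = G T'.
  apply/ffunP => p; case: (boolP (p.2 < kap p.1)%N) => pk.
    by have [b <-] := posb _ pk; rewrite Gpos; apply/val_inj; rewrite /= ffunE.
  rewrite Gout //; have /grid_tabP [/(_ p.1 p.2) + _ _] := gT.
  by rewrite (negbTE pk) -surjective_pairing => /eqP e; apply/val_inj.
by exists T'; rewrite // inE -grid_tabG -e.
Qed.

End Tableaux.

(** * Specialisations of the determinant *)

Section HsTheory.
Variables R S : comNzRingType.
Implicit Types (x : nat -> R) (s : nat -> bool).

Lemma eq_super_h x x' s s' n : (forall i, (i < n)%N -> x i = x' i) ->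
  (forall i, (i < n)%N -> s i = s' i) -> super_h x s n = super_h x' s' n.
Proof. by move=> ex es; apply: eq_bigr => i _; rewrite ex ?es. Qed.

Lemma rmorph_conv (f : {rmorphism R -> S}) (a b : nat -> R) r :
  f (conv a b r) = conv (f \o a) (f \o b) r.
Proof. by rewrite rmorph_sum; apply: eq_bigr => i _; rewrite rmorphM. Qed.

Lemma rmorph_super_h (f : {rmorphism R -> S}) x s n r :
  f (super_h x s n r) = super_h (f \o x) s n r.
Proof.
elim: n r => [|n IH] r; first by rewrite !super_h0 /conv1 rmorph_nat.
rewrite !super_hS rmorph_conv; congr conv; first by apply/funext => i; apply: IH.
by apply/funext => i; rewrite /letter /=; case: ifP; rewrite ?rmorph0 ?rmorphXn.
Qed.

Lemma rmorph_jt (f : {rmorphism R -> S}) a L (kap : 'I_L -> nat) :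
  f (jt a kap) = jt (f \o a) kap.
Proof.
rewrite /jt -det_map_mx; congr (\det _); apply/matrixP => i j; rewrite !mxE.
by case: ifP => //; rewrite rmorph0.
Qed.

Lemma eq_jt (a a' : nat -> R) L (kap : 'I_L -> nat) d :
  (forall i, (kap i + i <= d)%N) -> (forall r, (r <= d)%N -> a r = a' r) ->
  jt a kap = jt a' kap.
Proof.
move=> kd aa; rewrite /jt; congr (\det _); apply/matrixP => i j; rewrite !mxE.
by case: ifP => // _; apply: aa; apply: leq_trans (leq_subr _ _) (kd i).
Qed.

(** Each letter contributes both of its factors, whatever its type. *)
Lemma super_h_negb x s n : conv (super_h x s n) (super_h x (negb \o s) n) =
  conv (super_h x xpred0 n) (super_h x xpredT n).
Proof.
rewrite /super_h -!big_split; apply: eq_bigr => i _ /=.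
by case: (s i) => //=; rewrite convC.
Qed.

Lemma super_h_double x y s n : (forall i, (i < n)%N -> y i = x i /\ y (n + i)%N = x i) ->
  super_h y s (n + n) = conv (super_h x s n) (super_h x (fun i => s (n + i)%N) n).
Proof.
move=> xy; rewrite /super_h big_split_ord /=; congr conv; apply: eq_bigr => i _ /=.
  by have [-> _] := xy i (ltn_ord i).
by have [_ ->] := xy i (ltn_ord i).
Qed.

Lemma super_h_true x n r :
  super_h x xpredT n r = \sum_(J : {set 'I_n} | #|J| == r) \prod_(i in J) x i.
Proof.
have -> : super_h x xpredT n r = (\prod_(i < n) (1 + (x i)%:P * 'X))`_r.
  elim: n r => [|n IH] r; first by rewrite super_h0 big_ord0 coef1.
  rewrite super_hS big_ord_recr coefM /=; apply: eq_bigr => i _; rewrite IH; congr (_ * _).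
  rewrite /letter coefD coef1 coefCM coefX.
  by case: (r - i)%N => [|[|m]] /=; rewrite ?expr0 ?expr1 ?mulr1 ?mulr0 ?addr0 ?add0r.
rewrite (eq_bigr (fun i : 'I_n => (x i)%:P * 'X + 1)); last by move=> i _; rewrite addrC.
rewrite bigA_distr coef_sum [RHS]big_mkcond; apply: eq_bigr => J _.
rewrite -big_mkcond big_split /= prodr_const -rmorph_prod /= coefCM coefXn eq_sym.
by case: eqP; rewrite ?mulr1 ?mulr0.
Qed.

End HsTheory.

(** * Partitions, conjugates, and Jacobi-Trudi for Young diagrams *)

Lemma geq_trans : transitive geq.
Proof. by move=> a b c ba ac; apply: leq_trans ac ba. Qed.

Lemma nth_geq (sh : seq nat) i j : sorted geq sh -> (i <= j)%N ->
  (nth 0%N sh j <= nth 0%N sh i)%N.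
Proof.
move=> srt ij; case: (ltnP j (size sh)) => js; last by rewrite nth_default.
by apply: (sorted_leq_nth geq_trans leqnn 0%N srt) => //; apply: leq_ltn_trans js.
Qed.

(** Both sides say that the diagram has a box in row i and column j: as the sequence is sorted, the
    parts exceeding j come first. *)
Lemma conj_seqP (sh : seq nat) i j : sorted geq sh ->
  (i < nth 0%N (conj_seq sh) j)%N = (j < nth 0%N sh i)%N.
Proof.
move=> srt; have H : (i < count (fun r => j < r)%N sh)%N = (j < nth 0%N sh i)%N.
  elim: sh i srt => [|a sh IH] i /=; first by rewrite nth_nil.
  rewrite (path_sortedE geq_trans) => /andP [/allP al srt].
  case: (ltnP j a) => ja /=.
    by case: i => [|i] /=; rewrite ?ja // ltnS IH.
  have -> : count (fun r => j < r)%N sh = 0%N.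
    apply/eqP; rewrite -leqn0 leqNgt -has_count; apply/hasPn => r /al /= ra.
    by rewrite -leqNgt (leq_trans ra).
  case: i => [|i] /=; first by rewrite [RHS]ltnNge ja.
  symmetry; apply/negbTE; rewrite -leqNgt; case: (ltnP i (size sh)) => ish.
    by apply: leq_trans ja; apply: al; apply: mem_nth.
  by rewrite nth_default.
case: (ltnP j (head 0%N sh)) => jh.
  by rewrite (nth_map 0%N) ?size_iota // nth_iota.
rewrite nth_default ?size_map ?size_iota // ltn0; symmetry; apply/negbTE; rewrite -leqNgt.
case: (ltnP i (size sh)) => ish; last by rewrite nth_default.
apply: leq_trans jh; rewrite -nth0.
exact: nth_geq.
Qed.

Section Shapes.
Implicit Type la : intpart.

Lemma intpart_sorted la : sorted geq la.
Proof. by have /andP [] := intpartP la. Qed.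

Definition incr_parts L (sh : seq nat) (i : 'I_L) : nat := nth 0%N sh (L - i.+1).

Lemma incr_parts_incr L sh : sorted geq sh -> weakly_incr (@incr_parts L sh).
Proof. by move=> srt i j ij; apply: nth_geq => //; rewrite leq_sub2l. Qed.

Lemma box_lt la (b : box la) : (bcol b < nth 0%N la (brow b))%N.
Proof. exact: ltn_ord. Qed.

Lemma box_inj la (b b' : box la) : brow b = brow b' -> bcol b = bcol b' -> b = b'.
Proof.
case: b b' => i j [i' j']; rewrite /brow /bcol /= => e.
move/val_inj: e j j' => -> j j' /val_inj -> //.
Qed.

Lemma box_ex la i j : (j < nth 0%N la i)%N -> exists2 b : box la, brow b = i & bcol b = j.
Proof.
move=> ji; have ila : (i < size la)%N.
  by rewrite ltnNge; apply: contraTN ji => ?; rewrite nth_default.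
by exists (Tagged (fun i : 'I_(size la) => 'I_(nth 0%N la i)) (i := Ordinal ila) (Ordinal ji)).
Qed.

Definition super_schur (R : comNzRingType) (x : nat -> R) s n la : R :=
  @tab_sum (box la) (@brow la) (@bcol la) R x s n.

Lemma super_tab_swap (B : finType) (r c : B -> nat) n s (T : {ffun B -> 'I_n}) :
  super_tab r c s T = super_tab c r (negb \o s) T.
Proof.
apply: eq_forallb => b; apply: eq_forallb => b'; rewrite andbC; congr andb.
by rewrite /= negbK.
Qed.

Lemma super_schur_jt (R : comNzRingType) (x : nat -> R) s n la L : (size la <= L)%N ->
  super_schur x s n la = jt (super_h x s n) (@incr_parts L la).
Proof.
move=> sL; apply: tab_sum_jt.
- exact/incr_parts_incr/intpart_sorted.
- exact: box_inj.
- move=> b; have bL : (brow b < L)%N by apply: leq_trans sL; apply: ltn_ord.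
  exists (rev_ord (Ordinal bL)) => /=; first lia.
  by rewrite /incr_parts /= subnSK // subKn ?box_lt // ltnW.
- by move=> i j /box_ex [b]; exists b.
Qed.

Lemma super_schur_jt_conj (R : comNzRingType) (x : nat -> R) s n la L :
  (size (conj_part la) <= L)%N ->
  super_schur x s n la = jt (super_h x (negb \o s) n) (@incr_parts L (conj_part la)).
Proof.
move=> sL; rewrite /super_schur /tab_sum; under eq_bigl => T do rewrite super_tab_swap.
have P i j := @conj_seqP la i j (intpart_sorted la).
apply: (@tab_sum_jt _ (@bcol la) (@brow la)).
- exact/incr_parts_incr/intpart_sorted.
- by move=> b b' ? ?; apply: box_inj.
- move=> b; have bl := box_lt b; rewrite -P in bl.
  have bL : (bcol b < L)%N.
    apply: leq_trans sL; rewrite ltnNge; apply: contraTN bl => H.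
    by rewrite nth_default.
  exists (rev_ord (Ordinal bL)) => /=; first lia.
  by rewrite /incr_parts /= subnSK // subKn // ltnW.
- by move=> i j; rewrite P => /box_ex [b ? ?]; exists b.
Qed.

Lemma conj_conj_nth la i : nth 0%N (conj_part (conj_part la)) i = nth 0%N la i.
Proof.
have P j : (j < nth 0%N (conj_part (conj_part la)) i)%N = (j < nth 0%N la i)%N.
  rewrite (conj_seqP j i (intpart_sorted (conj_part la))).
  exact: conj_seqP (intpart_sorted la).
apply/eqP; rewrite eqn_leq; apply/andP; split.
  by rewrite leqNgt P ltnn.
by rewrite leqNgt -P ltnn.
Qed.

(** Letters are indexed by [nat] in [super_h]. The default 0 also makes the generic series of
    [super_inv_conj0] stop at degree n. *)
Definition var_seq n : nat -> {mpoly rat[n]} := fun i => if insub i is Some j then 'X_j else 0.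

Lemma var_seqE n (i : 'I_n) : var_seq n i = 'X_i.
Proof. by rewrite /var_seq valK. Qed.

Lemma contentE n la (T : {ffun box la -> 'I_n}) : content T = \prod_b var_seq n (T b).
Proof.
rewrite (partition_big T predT) //=; apply: eq_bigr => j _.
rewrite (eq_bigr (fun=> 'X_j)); last by move=> b /eqP ->; rewrite var_seqE.
by rewrite prodr_const; congr (_ ^+ _); apply: eq_card => b; rewrite inE.
Qed.

Lemma hook_schurE k l la : hook_schur k l la = super_schur (var_seq (k + l)) (leq k) (k + l) la.
Proof.
apply: eq_big => [T|T _]; last exact: contentE.
by apply: eq_forallb => b; apply: eq_forallb => b'; rewrite -ltnNge.
Qed.

Lemma schur_polyE n la : schur_poly n la = super_schur (var_seq n) xpred0 n la.
Proof.
apply: eq_big => [T|T _]; last exact: contentE.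
apply: eq_forallb => b; apply: eq_forallb => b' /=; rewrite implybT andbT.
by rewrite implybF (_ : (T b < T b')%N = (T b <= T b')%N && (T b != T b')) // ltn_neqAle andbC.
Qed.

Lemma super_h_mesym n r : super_h (var_seq n) xpredT n r = mesym n rat r.
Proof.
rewrite super_h_true /mesym; apply: eq_bigr => J _; apply: eq_bigr => i _.
by rewrite var_seqE.
Qed.

End Shapes.

(** * Symmetric functions as polynomials in the elementary ones *)

Definition ev n (f : symfun) : {mpoly rat[n]} := symfun_val f n.

Fact ev_zmod n : GRing.zmod_morphism (ev n). Proof. by []. Qed.
Fact ev_monoid n : GRing.monoid_morphism (ev n). Proof. by []. Qed.
HB.instance Definition _ n :=
  GRing.isZmodMorphism.Build symfun {mpoly rat[n]} (ev n) (@ev_zmod n).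
HB.instance Definition _ n :=
  GRing.isMonoidMorphism.Build symfun {mpoly rat[n]} (ev n) (@ev_monoid n).

Lemma evZ n c f : ev n (c *: f) = c *: ev n f. Proof. by []. Qed.
Arguments ev : simpl never.

Lemma symfunP (f g : symfun) : (forall n, ev n f = ev n g) -> f = g.
Proof. by move=> fg; apply/val_inj/mpolyseqP. Qed.

Lemma symfun_props (f : symfun) :
  [/\ forall n, ev n f \is symmetric, forall n, drop_last (ev n.+1 f) = ev n f
    & exists d, forall n, (msize (ev n f) <= d)%N].
Proof. by case: f => v v_in; have /asboolP := v_in. Qed.

Lemma symfun_sym n f : ev n f \is symmetric.
Proof. by case: (symfun_props f). Qed.

(** * Degree bounds and the loss of the last variable *)

Section Degree.
Variable n : nat.
Implicit Type p : {mpoly rat[n]}.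

Lemma msizeM_le_add p q a b : (msize p <= a.+1)%N -> (msize q <= b.+1)%N ->
  (msize (p * q) <= (a + b).+1)%N.
Proof.
move=> pa qb; have [->|p0] := eqVneq p 0; first by rewrite mul0r msize0.
have [->|q0] := eqVneq q 0; first by rewrite mulr0 msize0.
by rewrite msizeM //; move: pa qb; move: (msize p) (msize q); lia.
Qed.

Lemma msize_expr_le p k a : (msize p <= a.+1)%N -> (msize (p ^+ k) <= (k * a).+1)%N.
Proof.
move=> pa; elim: k => [|k IH]; first by rewrite expr0 msize1.
by rewrite exprS mulSn; apply: msizeM_le_add.
Qed.

Lemma msize_prod_le (I : Type) (r : seq I) (P : pred I) (F : I -> {mpoly rat[n]}) (w : I -> nat) :
  (forall i, P i -> msize (F i) <= (w i).+1)%N ->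
  (msize (\prod_(i <- r | P i) F i) <= (\sum_(i <- r | P i) w i).+1)%N.
Proof.
move=> H; elim/big_rec2: _ => [|i k p Pi]; first by rewrite msize1.
by move=> IH; apply: msizeM_le_add => //; apply: H.
Qed.

Lemma msize_sum_le (I : eqType) (r : seq I) (P : pred I) (F : I -> {mpoly rat[n]}) d :
  (forall i, i \in r -> P i -> msize (F i) <= d)%N ->
  (msize (\sum_(i <- r | P i) F i) <= d)%N.
Proof.
move=> H; rewrite big_seq_cond; elim/big_rec: _ => [|i p /andP [ir Pi] IH].
  by rewrite msize0.
by apply: leq_trans (msizeD_le _ _) _; rewrite geq_max H.
Qed.

Lemma msize_mesym_le r : (msize (mesym n rat r) <= r.+1)%N.
Proof.
apply: msize_sum_le => J _ /eqP <-; rewrite -sum1_card.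
by apply: msize_prod_le => i _; rewrite msizeX mdeg1.
Qed.

Lemma mcoeff_drop_last (p : {mpoly rat[n.+1]}) m :
  (drop_last p)@_m = p@_(mnmwiden m).
Proof.
rewrite /drop_last comp_mpolyEX [in RHS](mpolyE p) !raddf_sum; apply: eq_bigr => k _ /=.
rewrite !mcoeffZ mcoeffX comp_mpolyX; congr (_ * _).
rewrite big_ord_recr /= tnth_mktuple unlift_none.
have E (i : 'I_n) : tnth [tuple if unlift ord_max i is Some j then 'X_j else 0 | i < n.+1]
    (widen_ord (leqnSn n) i) = 'X_i :> {mpoly rat[n]}.
  rewrite tnth_mktuple; have -> : widen_ord (leqnSn n) i = lift ord_max i.
    by apply/val_inj; rewrite /= /bump leqNgt ltn_ord.
  by rewrite liftK.
under eq_bigr => i _ do rewrite E.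
pose k' := [multinom k (widen_ord (leqnSn n) i) | i < n].
have -> : \prod_(i < n) 'X_i ^+ k (widen_ord (leqnSn n) i) = 'X_[k'] :> {mpoly rat[n]}.
  by rewrite mpolyXE_id; apply: eq_bigr => i _; rewrite mnmE.
have [k0|k0] := posnP (k ord_max).
  rewrite k0 expr0 mulr1 mcoeffX; congr (nat_of_bool _)%:R; apply/eqP/eqP => [<-|ke].
    apply/mnmP => i; have [j ->|->] := unliftP ord_max i; last by rewrite k0 mnmwiden_ordmax.
    have -> : lift ord_max j = widen_ord (leqnSn n) j.
      by apply/val_inj; rewrite /= /bump leqNgt ltn_ord.
    by rewrite mnmwiden_widen mnmE.
  by apply/mnmP => i; rewrite mnmE ke mnmwiden_widen.
rewrite -(prednK k0) expr0n /= mulr0 mcoeff0; case: eqP => // ke.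
by move: k0; rewrite ke mnmwiden_ordmax.
Qed.

(** The degree is at most n, so each monomial omits one of the n + 1 variables. By symmetry this may
    be taken to be the last one, and such coefficients survive in [drop_last p]. *)
Lemma symmetric_drop_last_eq0 (p : {mpoly rat[n.+1]}) : p \is symmetric ->
  (msize p <= n.+1)%N -> drop_last p = 0 -> p = 0.
Proof.
move=> psym pn dp; apply/eqP; rewrite -msupp_eq0; case e: (msupp p) => [//|m ms].
have mp : m \in msupp p by rewrite e mem_head.
have [i mi] : exists i, m i = 0%N.
  apply/not_existsP => H; have := leq_trans (msize_mdeg_lt mp) pn.
  rewrite ltnNge mdegE => /negP; apply.
  rewrite -[X in (X <= _)%N](card_ord n.+1) -sum1_card; apply: leq_sum => i _.
  by rewrite lt0n; apply/eqP; apply: H.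
pose sg := tperm i ord_max; pose m' := [multinom m (sg j) | j < n.+1].
have : p@_m' = p@_m by exact: msym_coeff.
have -> : m' = mnmwiden [multinom m' (widen_ord (leqnSn n) j) | j < n].
  apply/mnmP => j; have [k ->|->] := unliftP ord_max j.
    have -> : lift ord_max k = widen_ord (leqnSn n) k.
      by apply/val_inj; rewrite /= /bump leqNgt ltn_ord.
    by rewrite mnmwiden_widen mnmE.
  by rewrite mnmwiden_ordmax mnmE tpermR mi.
rewrite -mcoeff_drop_last dp mcoeff0 => /esym/eqP.
by rewrite mcoeff_eq0 mp.
Qed.

End Degree.

(** The e-series is a product over the letters, and a letter set to 0 contributes the factor 1. *)
Lemma drop_last_mesym n r : drop_last (mesym n.+1 rat r) = mesym n rat r.
Proof.
pose lq := [tuple if unlift ord_max i is Some j then 'X_j else 0 : {mpoly rat[n]} | i < n.+1].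
rewrite -!super_h_mesym.
transitivity (comp_mpoly lq (super_h (var_seq n.+1) xpredT n.+1 r)); first by [].
rewrite rmorph_super_h super_hS.
have -> : letter true ((comp_mpoly lq \o var_seq n.+1) n) = @conv1 _.
  apply/funext => i /=; rewrite -[n in var_seq _ n]/(val (ord_max : 'I_n.+1)) var_seqE comp_mpolyXU.
  rewrite -tnth_nth tnth_mktuple unlift_none /letter /conv1.
  by case: i => [|[|i]] //=; rewrite expr0n.
rewrite convC conv1f; apply: (congr1 (@^~ r)); apply: eq_super_h => // i ilt /=.
have -> : var_seq n.+1 i = 'X_(lift ord_max (Ordinal ilt)).
  rewrite -var_seqE /=; congr var_seq; by rewrite /bump leqNgt ilt.
by rewrite comp_mpolyXU -tnth_nth tnth_mktuple liftK -var_seqE.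
Qed.

Fact esf_subproof r : (fun n => mesym n rat r) \in symfun_pred.
Proof.
apply/asboolP; split=> [n|n|]; first exact: mesym_sym.
  exact: drop_last_mesym.
by exists r.+1 => n; apply: msize_mesym_le.
Qed.

Definition esf r : symfun := SymFun (esf_subproof r).

Lemma ev_esf n r : ev n (esf r) = mesym n rat r. Proof. by []. Qed.

Lemma esf0 : esf 0 = 1.
Proof. by apply: symfunP => n; rewrite ev_esf mesym0E rmorph1. Qed.

Lemma ev_esf_super_h n : ev n \o esf = super_h (var_seq n) xpredT n.
Proof. by apply/funext => r; rewrite super_h_mesym. Qed.

Local Notation ES n := [tuple mesym n rat i.+1 | i < n].

Definition poly_esf d (t : {mpoly rat[d]}) : symfun :=
  \sum_(m <- msupp t) t@_m *: \prod_(i < d) esf i.+1 ^+ m i.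

Lemma ev_poly_esf n d (t : {mpoly rat[d]}) :
  ev n (poly_esf t) = t \mPo [tuple mesym n rat i.+1 | i < d].
Proof.
rewrite comp_mpolyEX rmorph_sum; apply: eq_bigr => m _ /=.
rewrite evZ rmorph_prod comp_mpolyX; congr (_ *: _).
by apply: eq_bigr => i _; rewrite rmorphXn /= ev_esf tnth_mktuple.
Qed.

Definition esf_coords d (f : symfun) : {mpoly rat[d]} := sval (sym_fundamental (symfun_sym d f)).

Lemma esf_coordsP d f : esf_coords d f \mPo ES d = ev d f.
Proof. by rewrite /esf_coords; case: sym_fundamental => t []. Qed.

Lemma esf_coords_mweight d f : (mweight (esf_coords d f) <= msize (ev d f))%N.
Proof. by rewrite /esf_coords; case: sym_fundamental => t []. Qed.

(** The difference vanishes in d variables, hence in fewer. The weight bound on the coordinates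
    keeps its degree below d in any number of variables, so [symmetric_drop_last_eq0] carries the
    vanishing upwards. *)
Lemma poly_esf_coords (f : symfun) :
  exists d0, forall d, (d0 <= d)%N -> poly_esf (esf_coords d f) = f.
Proof.
have [_ _ [d0 fd0]] := symfun_props f; exists d0 => d d0d.
apply/eqP; rewrite -subr_eq0; set h := _ - f; apply/eqP.
have hd : ev d h = 0 by rewrite rmorphB /= ev_poly_esf esf_coordsP subrr.
have hsz n : (msize (ev n h) <= d)%N.
  rewrite rmorphB /=; apply: leq_trans (msizeD_le _ _) _; rewrite msizeN geq_max.
  rewrite (leq_trans (fd0 n)) // andbT ev_poly_esf comp_mpolyEX.
  apply: msize_sum_le => m mt _; apply: leq_trans (msizeZ_le _ _) _.
  rewrite comp_mpolyX.
  have mw : (mnmwgt m < mweight (esf_coords d f))%N by apply: mmeasure_mnm_lt.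
  apply: (@leq_trans (mnmwgt m).+1); last first.
    by apply: leq_trans mw _; apply: leq_trans (esf_coords_mweight _ _) (leq_trans (fd0 d) d0d).
  apply: msize_prod_le => i _; rewrite tnth_mktuple.
  exact/msize_expr_le/msize_mesym_le.
have hsym n := symfun_sym n h.
have hdrop n : drop_last (ev n.+1 h) = ev n h by have [] := symfun_props h.
have drop0 n : drop_last (0 : {mpoly rat[n.+1]}) = 0 by exact: comp_mpoly0.
apply: symfunP => n; rewrite rmorph0; case: (leqP d n) => dn.
  elim: n dn => [|n IH]; first by rewrite leqn0 => /eqP dn; move: hd; rewrite dn.
  rewrite leq_eqVlt => /orP [/eqP <- //|dn].
  apply: symmetric_drop_last_eq0 => //; last by rewrite hdrop IH.
  by apply: leq_trans (hsz _) _; apply: ltnW.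
move: {dn}(ltnW dn) => nd; rewrite -(subKn nd); move: (d - n)%N => k.
elim: k => [|k IH]; first by rewrite subn0.
case: (leqP d k) => dk; first by move: IH; rewrite subnS; have -> : (d - k = 0)%N by lia.
by move: IH; rewrite -(subnSK dk) => IH; rewrite -hdrop IH.
Qed.

Section EsfCoords.
Variable d : nat.

(** Algebraic independence of e_1, ..., e_d; it makes the chosen coordinates compatible with the
    ring operations. *)
Lemma esf_coords_uniq t f : t \mPo ES d = ev d f -> esf_coords d f = t.
Proof. by move=> tf; apply: msym_fundamental_un; rewrite esf_coordsP. Qed.

Fact esf_coords_zmod : GRing.zmod_morphism (esf_coords d).
Proof. by move=> f g; apply: esf_coords_uniq; rewrite comp_mpolyB !esf_coordsP rmorphB. Qed.

Fact esf_coords_monoid : GRing.monoid_morphism (esf_coords d).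
Proof.
split; first by apply: esf_coords_uniq; rewrite comp_mpoly1 rmorph1.
by move=> f g; apply: esf_coords_uniq; rewrite rmorphM /= !esf_coordsP rmorphM.
Qed.

Fact esf_coords_scalable : scalable (esf_coords d).
Proof. by move=> c f; apply: esf_coords_uniq; rewrite comp_mpolyZ esf_coordsP. Qed.

HB.instance Definition _ :=
  GRing.isZmodMorphism.Build symfun {mpoly rat[d]} (esf_coords d) esf_coords_zmod.
HB.instance Definition _ :=
  GRing.isMonoidMorphism.Build symfun {mpoly rat[d]} (esf_coords d) esf_coords_monoid.

Lemma esf_coords_esf (i : 'I_d) : esf_coords d (esf i.+1) = 'X_i.
Proof. by apply: esf_coords_uniq; rewrite comp_mpolyXU -tnth_nth tnth_mktuple. Qed.

End EsfCoords.

Section esf_subst.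
Variables (d n : nat) (a : nat -> {mpoly rat[n]}).

(* The elementary symmetric functions of degree above d are sent to 0, so esf_subst
   is only meaningful on symmetric functions of degree at most d. *)
Definition esf_subst : symfun -> {mpoly rat[n]} :=
  comp_mpoly [tuple a i.+1 | i < d] \o esf_coords d.

HB.instance Definition _ :=
  GRing.RMorphism.copy esf_subst (comp_mpoly [tuple a i.+1 | i < d] \o esf_coords d).

Lemma esf_substZ c f : esf_subst (c *: f) = c *: esf_subst f.
Proof. by rewrite /esf_subst /= esf_coords_scalable comp_mpolyZ. Qed.

Lemma esf_subst_esf r : a 0%N = 1 -> (r <= d)%N -> esf_subst (esf r) = a r.
Proof.
move=> a0; case: r => [_|r rd]; first by rewrite esf0 a0 rmorph1.
rewrite /esf_subst /= -[r]/(val (Ordinal rd)) esf_coords_esf comp_mpolyXU.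
by rewrite -tnth_nth tnth_mktuple.
Qed.

End esf_subst.

Lemma comp_mpolyA d n n' (t : {mpoly rat[d]}) (A : d.-tuple {mpoly rat[n]})
    (B : n.-tuple {mpoly rat[n']}) :
  (t \mPo A) \mPo B = t \mPo [tuple tnth A i \mPo B | i < d].
Proof.
rewrite [RHS]comp_mpolyEX [t \mPo _]comp_mpolyEX rmorph_sum; apply: eq_bigr => m _ /=.
rewrite comp_mpolyZ; congr (_ *: _); rewrite !comp_mpolyX rmorph_prod.
by apply: eq_bigr => i _; rewrite rmorphXn /= tnth_mktuple.
Qed.

Lemma comp_mpoly_esf_subst d n n' (a : nat -> {mpoly rat[n]}) (lq : n.-tuple {mpoly rat[n']}) f :
  esf_subst d a f \mPo lq = esf_subst d (comp_mpoly lq \o a) f.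
Proof.
rewrite /esf_subst /= comp_mpolyA; congr (_ \mPo _).
by apply: eq_from_tnth => i; rewrite !tnth_mktuple.
Qed.

Lemma symfun_ind (P : symfun -> Prop) :
  (forall f g, P f -> P g -> P (f + g)) -> (forall f g, P f -> P g -> P (f * g)) ->
  (forall c f, P f -> P (c *: f)) -> P 0 -> P 1 -> (forall r, P (esf r)) ->
  forall f, P f.
Proof.
move=> PD PM PZ P0 P1 Pe f; have [d /(_ d (leqnn d)) <-] := poly_esf_coords f.
apply: (big_ind P) => // m _; apply: PZ; apply: (big_ind P) => // i _.
by elim: (m i) => [|k IH]; rewrite ?expr0 // exprS; apply: PM.
Qed.

(** * Schur functions span *)

(** Taking the dual Jacobi-Trudi determinant as the definition makes membership in [symfun]
    automatic and ring maps easy to apply. *)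
Definition schurS (la : intpart) : symfun :=
  jt esf (@incr_parts (size (conj_part la)) (conj_part la)).

Lemma ev_jt n L (kap : 'I_L -> nat) : ev n (jt esf kap) = jt (super_h (var_seq n) xpredT n) kap.
Proof. by rewrite rmorph_jt ev_esf_super_h. Qed.

Lemma ev_schurS n la : ev n (schurS la) = schur_poly n la.
Proof. by rewrite ev_jt schur_polyE (super_schur_jt_conj _ _ _ (leqnn _)). Qed.

Lemma schurSE la : symfun_val (schurS la) = schur la.
Proof. by apply: mpolyseqP => n; apply: ev_schurS. Qed.

Lemma schurS_jt la L : (size (conj_part la) <= L)%N ->
  schurS la = jt esf (@incr_parts L (conj_part la)).
Proof.
move=> sL; apply: symfunP => n.
by rewrite ev_schurS ev_jt schur_polyE (super_schur_jt_conj _ _ _ sL).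
Qed.

(** Bounds the indices of the [esf] in the determinant [schurS la], so [esf_subst d] truncates
    nothing in it from this d on. *)
Definition jt_bound (la : intpart) : nat :=
  \max_(i < size (conj_part la)) (incr_parts (conj_part la) i + i).

Lemma esf_subst_schurS_jt d n (a : nat -> {mpoly rat[n]}) la : a 0%N = 1 -> (jt_bound la <= d)%N ->
  esf_subst d a (schurS la) = jt a (@incr_parts (size (conj_part la)) (conj_part la)).
Proof.
move=> a0 lad; rewrite rmorph_jt; apply: (@eq_jt _ _ _ _ _ d) => [i|r rd].
  by apply: leq_trans lad; apply: (bigmax_sup i).
exact: esf_subst_esf.
Qed.

Lemma esf_subst_schurS d n x s N la : (jt_bound la <= d)%N ->
  esf_subst d (super_h x (negb \o s) N) (schurS la) = super_schur x s N la :> {mpoly rat[n]}.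
Proof.
move=> lad.
by rewrite esf_subst_schurS_jt ?super_h_0 // (super_schur_jt_conj _ _ _ (leqnn _)).
Qed.

Section Span.

Definition in_span (f : symfun) :=
  exists s : seq (rat * intpart), f = \sum_(p <- s) p.1 *: schurS p.2.

Lemma in_spanD f g : in_span f -> in_span g -> in_span (f + g).
Proof. by move=> [s ->] [t ->]; exists (s ++ t); rewrite big_cat. Qed.

Lemma in_spanZ c f : in_span f -> in_span (c *: f).
Proof.
move=> [s ->]; exists [seq (c * p.1, p.2) | p <- s].
by rewrite scaler_sumr big_map; apply: eq_bigr => p _; rewrite scalerA.
Qed.

Lemma in_span0 : in_span 0.
Proof. by exists [::]; rewrite big_nil. Qed.

Lemma in_span_schurS la : in_span (schurS la).
Proof. by exists [:: (1, la)]; rewrite big_seq1 scale1r. Qed.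

Lemma nth_filter_pos (t : seq nat) i : sorted geq t ->
  nth 0%N [seq y <- t | (0 < y)%N] i = nth 0%N t i.
Proof.
elim: t i => [|a t IH] i //=; rewrite (path_sortedE geq_trans) => /andP [/allP al srt].
case: (posnP a) => [a0|a0] /=; last by case: i => [|i] //=; apply: IH.
rewrite IH //; case: i => [|i] /=.
  case: t al {IH srt} => [|b t] al /=; first by rewrite a0.
  by apply/eqP; rewrite a0 -leqn0 -a0; apply: al; rewrite mem_head.
have z j : nth 0%N t j = 0%N.
  case: (ltnP j (size t)) => jt; last by rewrite nth_default.
  by apply/eqP; rewrite -leqn0 -a0; apply: al; apply: mem_nth.
by rewrite !z.
Qed.

(** Reversing and dropping zeros gives a partition; its conjugate is taken because [schurS]
    conjugates again. *)
Lemma shape_of_sorted (s : seq nat) : sorted leq s ->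
  exists2 la, (size (conj_part la) <= size s)%N &
    forall i : 'I_(size s), incr_parts (conj_part la) i = nth 0%N s i.
Proof.
move=> srt.
have srt' : sorted geq (rev s) by rewrite rev_sorted.
have mu_part : is_part [seq y <- rev s | (0 < y)%N].
  apply/andP; split; last by rewrite mem_filter.
  by apply: sorted_filter srt'; apply: geq_trans.
pose mu := IntPart mu_part; exists (conj_part mu).
  rewrite /= size_map size_iota -nth0 leqNgt.
  rewrite (conj_seqP (size s) 0 (intpart_sorted mu)) nth_default //=.
  by rewrite size_filter -(size_rev s) count_size.
move=> i; rewrite /incr_parts conj_conj_nth nth_filter_pos //.
by rewrite nth_rev; [congr nth|]; have := ltn_ord i; lia.
Qed.

(** Let i be the largest index moved by w. Parts beyond i are unchanged, while w i < i makes part i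
    grow; the base L + 1 exceeds the number of parts, so this one power outweighs all the old parts
    up to kap_i. *)
Lemma jt_measure L (kap : 'I_L -> nat) (w : 'S_L) : weakly_incr kap -> w != 1%g ->
  (forall i, w i <= kap i + i)%N ->
  (\sum_i L.+1 ^ kap i < \sum_i L.+1 ^ (kap i + i - w i))%N.
Proof.
move=> mk w1 wk.
have [i1 wi1] : exists i, w i != i.
  case: (boolP [exists i, w i != i]) => [/existsP //|/existsPn H].
  by case/eqP: w1; apply/permP => i; rewrite perm1; apply/eqP; have := H i; rewrite negbK.
case: (@arg_maxnP _ i1 (fun i => w i != i) (fun i => i : nat) wi1) => i wi imax.
have L0 : (0 < L)%N by apply: leq_ltn_trans (ltn_ord i).
have fixed (k : 'I_L) : (i < k)%N -> w k = k.
  by move=> ik; apply/eqP; apply: contraTT ik => /imax; rewrite -leqNgt.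
have wlt : (w i < i)%N.
  rewrite ltn_neqAle wi /= leqNgt; apply/negP => iw.
  by move/perm_inj: (fixed _ iw) => e; move: iw; rewrite e ltnn.
rewrite (bigID (fun k : 'I_L => i < k)%N) [in ltnRHS](bigID (fun k : 'I_L => i < k)%N) /=.
have -> : (\sum_(k < L | i < k) L.+1 ^ kap k = \sum_(k < L | i < k) L.+1 ^ (kap k + k - w k))%N.
  by apply: eq_bigr => k ik; rewrite fixed // addnK.
rewrite ltn_add2l (bigD1 i) /= ?ltnn // [in ltnRHS](bigD1 i) /= ?ltnn //.
apply: (@leq_trans (L.+1 ^ (kap i).+1)%N); last first.
  by apply: leq_trans (leq_addr _ _); rewrite leq_exp2l // ltn_subRL addnC ltn_add2l.
rewrite -(bigD1 i (P := fun k : 'I_L => ~~ (i < k)%N) (F := fun k => (L.+1 ^ kap k)%N)) ?ltnn //=.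
apply: (@leq_ltn_trans (\sum_(k < L) L.+1 ^ kap i)%N).
  rewrite big_mkcond; apply: leq_sum => k _; case: ifP => // ki.
  by rewrite leq_exp2l //; apply: mk; rewrite leqNgt.
by rewrite sum_nat_const card_ord expnS mulSn -[X in (X < _)%N]add0n ltn_add2r expn_gt0.
Qed.

(** Triangularity: in the determinant for the sorted indices the identity gives the product itself,
    and any other permutation gives 0 or, up to sign, a product of equal length and total degree but
    larger measure. The measure is at most L (L + 1)^N, whence induction on the gap. *)
Lemma esf_prod_span (s : seq nat) : in_span (\prod_(y <- s) esf y).
Proof.
pose meas L (t : seq nat) := (\sum_(y <- t) L.+1 ^ y)%N.
suff H k : forall L N (u : seq nat), sumn u = N -> size u = L ->
    (L * L.+1 ^ N - meas L u < k)%N -> in_span (\prod_(y <- u) esf y).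
  exact: (H _ _ _ s erefl erefl (ltnSn _)).
elim: k => [//|k IH] {}L N {}s sN sL.
move=> sk; pose s' := sort leq s.
have ps : perm_eq s' s by rewrite perm_sort.
have srt : sorted leq s' by apply: sort_sorted leq_total _.
have sL' : size s' = L by rewrite (perm_size ps).
have [la laL laE] := shape_of_sorted srt.
pose kap (i : 'I_L) := nth 0%N s' i.
have prodE (R : Type) (idx : R) (op : Monoid.com_law idx) (F : nat -> R) :
    \big[op/idx]_(y <- s) F y = \big[op/idx]_(i < L) F (kap i).
  by rewrite -(perm_big _ ps) (big_nth 0%N) big_mkord sL'.
have mk : weakly_incr kap.
  move=> i j ij; apply: (sorted_leq_nth leq_trans leqnn 0%N srt) => //;
    by rewrite inE sL' ltn_ord.
have jtE : schurS la = jt esf kap.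
  rewrite (schurS_jt laL); rewrite sL' in laE *.
  congr (\det _); apply/matrixP => i j; rewrite !mxE.
  by rewrite laE.
have kN : (\sum_i kap i)%N = N by rewrite -sN sumnE (prodE _ _ _ id).
rewrite prodE.
have -> : \prod_i esf (kap i) = schurS la -
   \sum_(w : 'S_L | w != 1%g) (-1) ^+ w * \prod_i jt_entry esf (kap i + i) (w i).
  rewrite jtE [jt _ _](bigD1 1%g) //= odd_perm1 expr0 mul1r.
  have -> : \prod_i (\matrix_(i, j) (if (j <= kap i + i)%N then esf (kap i + i - j) else 0)) i
      ((1%g : 'S_L) i) = \prod_i esf (kap i).
    by apply: eq_bigr => i _; rewrite mxE perm1 leq_addl addnK.
  rewrite [X in _ + X - _](eq_bigr (fun w : 'S_L =>
    (-1) ^+ w * \prod_i jt_entry esf (kap i + i) (w i))).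
    by rewrite addrK.
  by move=> w _; congr (_ * _); apply: eq_bigr => i _; rewrite mxE.
apply: in_spanD; first exact: in_span_schurS.
rewrite -scaleN1r; apply: in_spanZ; apply: (big_ind in_span) => [||w w1].
- exact: in_span0.
- exact: in_spanD.
have -> : (-1) ^+ w * \prod_i jt_entry esf (kap i + i) (w i) =
    ((-1) ^+ w : rat) *: \prod_i jt_entry esf (kap i + i) (w i).
  by case: (odd_perm w);
    rewrite ?expr1 ?expr0 ?mulN1r ?scaleN1r ?mul1r ?scale1r.
apply: in_spanZ.
case: (boolP [forall i, (w i <= kap i + i)%N]) => [/forallP wk|]; last first.
  rewrite negb_forall => /existsP [i wi]; rewrite (bigD1 i) //= /jt_entry (negbTE wi) mul0r.
  exact: in_span0.
pose t := [seq (kap i + i - w i)%N | i : 'I_L].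
have tE (R : Type) (idx : R) (op : Monoid.com_law idx) (F : nat -> R) :
    \big[op/idx]_(y <- t) F y = \big[op/idx]_(i < L) F (kap i + i - w i)%N.
  by rewrite big_map big_enum.
have -> : \prod_i jt_entry esf (kap i + i) (w i) = \prod_(y <- t) esf y.
  by rewrite tE; apply: eq_bigr => i _; rewrite /jt_entry wk.
have tN : sumn t = N.
  rewrite sumnE (tE _ _ _ id) -kN; apply/eqP; rewrite -(eqn_add2r (\sum_i w i)) -big_split /=.
  rewrite (eq_bigr (fun i : 'I_L => kap i + i)%N); last by move=> i _; rewrite subnK.
  by rewrite big_split eqn_add2l [X in _ == X](reindex_inj (@perm_inj _ w^-1%g)) /=;
    apply/eqP/eq_bigr => i _; rewrite permKV.
apply: (IH L N) => //; first by rewrite size_map -cardE card_ord.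
have := jt_measure mk w1 wk.
rewrite -(prodE _ _ _ (expn L.+1)) -(tE _ _ _ (expn L.+1)) -/(meas L t) -/(meas L s) => lt.
have : (meas L t <= L * L.+1 ^ N)%N.
  rewrite /meas tE -[X in (X * _)%N](card_ord L) -sum_nat_const; apply: leq_sum => i _.
  rewrite leq_exp2l; last by rewrite ltnS (leq_ltn_trans _ (ltn_ord i)).
  by rewrite -tN sumnE (tE _ _ _ id) (bigD1 i) //= leq_addr.
by move: sk lt; rewrite -!/(meas L _) ltnS; lia.
Qed.

Lemma in_spanT f : in_span f.
Proof.
have [d /(_ d (leqnn d)) <-] := poly_esf_coords f.
apply: (big_ind in_span) => [||m _]; [exact: in_span0|exact: in_spanD|apply: in_spanZ].
have -> : \prod_(i < d) esf i.+1 ^+ m i =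
   \prod_(y <- flatten [seq nseq (m i) i.+1 | i : 'I_d]) esf y.
  rewrite big_flatten big_map big_enum; apply: eq_bigr => i _.
  by rewrite big_nseq; elim: (m i) => [|k IH]; rewrite ?expr0 // exprS IH.
exact: esf_prod_span.
Qed.

End Span.

(** * Doubly symmetric functions *)

Lemma mpolyseq_sumE (I : Type) (r : seq I) (F : I -> mpolyseq) n :
  (\sum_(i <- r) F i) n = \sum_(i <- r) F i n.
Proof. by apply: (big_morph (fun f : mpolyseq => f n)). Qed.

(** Coefficients of repeated partitions are added up. One [m] has to serve all [V] and [F], since
    the same expansion is read in Schur functions, Schur polynomials and hook Schur polynomials. *)
Lemma fsfun_of_seq (s : seq (rat * intpart)) :
  exists m : {fsfun intpart -> rat with 0},
    forall (V : lmodType rat) (F : intpart -> V),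
      \sum_(la <- finsupp m) m la *: F la = \sum_(p <- s) p.1 *: F p.2.
Proof.
pose K := seq_fset tt (map snd s).
pose m := [fsfun la in K => \sum_(p <- s | p.2 == la) p.1 | 0] : {fsfun intpart -> rat with 0}.
have mE la : m la = \sum_(p <- s | p.2 == la) p.1.
  rewrite fsfunE; case: ifP => // /negbT; rewrite seq_fsetE => laK.
  rewrite big_seq_cond big1 // => p /andP [ps /eqP e]; case/negP: laK.
  by rewrite -e map_f.
exists m => V F.
have -> : \sum_(la <- finsupp m) m la *: F la = \sum_(la <- K) m la *: F la.
  rewrite (big_fset_incl _ (_ : finsupp m `<=` K)%fset) //; first exact: finsupp_sub.
  by move=> la _; rewrite memNfinsupp => /eqP ->; rewrite scale0r.
transitivity (\sum_(la <- K) \sum_(p <- s | p.2 == la) p.1 *: F p.2).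
  apply: eq_bigr => la _; rewrite mE scaler_suml; apply: eq_bigr => p /eqP -> //.
rewrite (exchange_big_dep predT) //= big_seq [RHS]big_seq; apply: eq_bigr => p ps.
have pK : p.2 \in K by rewrite seq_fsetE map_f.
rewrite big_mkcond (bigD1_seq p.2 pK (fset_uniq K)) /=.
by rewrite eqxx big1 ?addr0 // => la; rewrite eq_sym => /negbTE ->.
Qed.

(** The bound [d0] is uniform in k and l. Letters are negated because the e-series of an unprimed
    letter is 1 + xt. *)
Definition super_inv (f : symfun) := exists d0, forall d, (d0 <= d)%N -> forall k l,
  esf_subst d (super_h (var_seq (k + l)) (negb \o leq k) (k + l)) f = ev (k + l) f.

Lemma esf_subst_hook d k l la : (jt_bound la <= d)%N ->
  esf_subst d (super_h (var_seq (k + l)) (negb \o leq k) (k + l)) (schurS la) = hook_schur k l la.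
Proof. by move=> lad; rewrite esf_subst_schurS // hook_schurE. Qed.

(** Both sides of the defining identity are images of f itself under ring maps, so the converse may
    use any expansion of f supplied by [in_spanT]. *)
Lemma doubly_symmetricP f : reflect (super_inv f) (f \in doubly_symmetric).
Proof.
apply: (iffP (asboolP _)) => [[m fE Hm]|[d0 fP]].
  have fS : f = \sum_(la <- finsupp m) m la *: schurS la.
    apply: symfunP => n; rewrite rmorph_sum /= /ev fE mpolyseq_sumE.
    by apply: eq_bigr => la _; rewrite -schurSE.
  exists (\max_(la <- finsupp m) jt_bound la) => d dm k l.
  rewrite {2}fS fS !rmorph_sum /=; under [RHS]eq_bigr do rewrite evZ ev_schurS.
  rewrite Hm !big_seq; apply: eq_bigr => la lam; rewrite esf_substZ esf_subst_hook //.
  by apply: leq_trans dm; apply: leq_bigmax_seq.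
have [s fs] := in_spanT f; have [m mE] := fsfun_of_seq s; exists m.
  rewrite (mE mpolyseq); apply: mpolyseqP => n; rewrite -[LHS]/(ev n f) fs.
  rewrite rmorph_sum mpolyseq_sumE; apply: eq_bigr => p _ /=.
  by rewrite evZ ev_schurS.
move=> k l; rewrite !(mE {mpoly rat[k + l]}).
pose d := maxn d0 (\max_(p <- s) jt_bound p.2).
have := fP d (leq_maxl _ _) k l; rewrite fs !rmorph_sum /= => H.
rewrite (eq_bigr (fun p => ev (k + l) (p.1 *: schurS p.2))); last first.
  by move=> p _; rewrite evZ ev_schurS.
rewrite -H !big_seq; apply: eq_bigr => p ps; rewrite esf_substZ esf_subst_hook //.
apply: leq_trans (leq_maxr _ _).
exact: (leq_bigmax_seq (F := fun p => jt_bound p.2)).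
Qed.

Lemma super_invB f g : super_inv f -> super_inv g -> super_inv (f - g).
Proof.
move=> [d0 fP] [d1 gP]; exists (maxn d0 d1) => d; rewrite geq_max => /andP [fd gd] k l.
by rewrite !rmorphB /= fP ?gP.
Qed.

Lemma super_invM f g : super_inv f -> super_inv g -> super_inv (f * g).
Proof.
move=> [d0 fP] [d1 gP]; exists (maxn d0 d1) => d; rewrite geq_max => /andP [fd gd] k l.
by rewrite !rmorphM /= fP ?gP.
Qed.

Lemma super_invZ c f : super_inv f -> super_inv (c *: f).
Proof. by move=> [d0 fP]; exists d0 => d dd k l; rewrite esf_substZ evZ fP. Qed.

Lemma super_inv1 : super_inv 1.
Proof. by exists 0%N => d _ k l; rewrite !rmorph1. Qed.

Lemma super_inv0 : super_inv 0.
Proof. by exists 0%N => d _ k l; rewrite !rmorph0. Qed.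

Lemma super_invD f g : super_inv f -> super_inv g -> super_inv (f + g).
Proof.
move=> fP gP; rewrite -[g]opprK -[- g]sub0r; apply: super_invB => //.
exact: super_invB super_inv0 gP.
Qed.

Lemma doubly_symmetric_closed : GRing.subring_closed doubly_symmetric.
Proof.
split=> [|f g /doubly_symmetricP fP /doubly_symmetricP gP
         |f g /doubly_symmetricP fP /doubly_symmetricP gP];
  apply/doubly_symmetricP.
- exact: super_inv1.
- exact: super_invB.
- exact: super_invM.
Qed.

(** * Every symmetric function is doubly symmetric modulo the ideal *)

Fact row_part_subproof r : is_part (nseq (0 < r) r).
Proof. by case: r. Qed.

Definition row_part r : intpart := IntPart (row_part_subproof r).

Lemma nth_row_part r : nth 0%N (row_part r) 0 = r. Proof. by case: r. Qed.

Lemma jt_size1 (R : comNzRingType) (a : nat -> R) (kap : 'I_1 -> nat) : jt a kap = a (kap ord0).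
Proof. by rewrite /jt det_mx11 mxE /= addn0 subn0. Qed.

Lemma super_schur_row (R : comNzRingType) (x : nat -> R) s n r :
  super_schur x s n (row_part r) = super_h x s n r.
Proof.
rewrite (@super_schur_jt _ _ _ _ _ 1); last by case: r.
by rewrite jt_size1 /incr_parts subnn nth_row_part.
Qed.

Lemma schurS_col r : schurS (conj_part (row_part r)) = esf r.
Proof.
rewrite (@schurS_jt _ 1).
  by rewrite jt_size1 /incr_parts subnn conj_conj_nth nth_row_part.
rewrite /= size_map size_iota -nth0 leqNgt.
rewrite (conj_seqP 1 0 (intpart_sorted (row_part r))) nth_default //=.
by case: r.
Qed.

Lemma mem_conj_ideal f la : f * (schurS la - schurS (conj_part la)) \in conj_ideal.
Proof.
apply/asboolP; exists [:: (f, la)]; rewrite big_seq1 /= -!schurSE; exact.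
Qed.

Lemma conj_idealP f : f \in conj_ideal ->
  exists s : seq (symfun * intpart),
    f = \sum_(p <- s) p.1 * (schurS p.2 - schurS (conj_part p.2)).
Proof.
move=> /asboolP [s fs]; exists s; apply: symfunP => n.
rewrite -[LHS]/(symfun_val f n) fs mpolyseq_sumE rmorph_sum; apply: eq_bigr => p _.
by rewrite -!schurSE.
Qed.

(* The coefficients of H(t)E(t): the super specialisation multiplies each letter
   by (1 + xt)/(1 - xt), whether primed or not. *)
Definition qsf : nat -> symfun := conv (schurS \o row_part) esf.

Lemma qsf_super_inv r : super_inv (qsf r).
Proof.
exists (maxn r (\max_(i < r.+1) jt_bound (row_part i))) => d; rewrite geq_max => /andP [rd bd] k l.
transitivity (conv (super_h (var_seq (k + l)) (leq k) (k + l))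
    (super_h (var_seq (k + l)) (negb \o leq k) (k + l)) r).
  rewrite rmorph_conv; apply: eq_bigr => i _ /=; congr (_ * _).
    rewrite esf_subst_schurS ?super_schur_row //.
    by apply: leq_trans bd; apply: (bigmax_sup i).
  by rewrite esf_subst_esf ?super_h_0 // (leq_trans (leq_subr _ _)).
rewrite super_h_negb rmorph_conv ev_esf_super_h; apply: eq_bigr => i _; congr (_ * _).
by rewrite /= ev_schurS schur_polyE super_schur_row.
Qed.

Definition mod_conj (f : symfun) := exists2 g, super_inv g & f - g \in conj_ideal.

Lemma conj_ideal_mul f g : g \in conj_ideal -> f * g \in conj_ideal.
Proof. exact: idealMr. Qed.

Lemma mod_conjD f g : mod_conj f -> mod_conj g -> mod_conj (f + g).
Proof.
move=> [f' f'P ff] [g' g'P gg]; exists (f' + g'); first exact: super_invD.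
by rewrite opprD addrACA rpredD.
Qed.

Lemma mod_conjM f g : mod_conj f -> mod_conj g -> mod_conj (f * g).
Proof.
move=> [f' f'P ff] [g' g'P gg]; exists (f' * g'); first exact: super_invM.
have -> : f * g - f' * g' = f * (g - g') + g' * (f - f').
  by rewrite !mulrBr addrA (mulrC g' f) subrK (mulrC g').
by rewrite rpredD // conj_ideal_mul.
Qed.

Lemma mod_conjZ c f : mod_conj f -> mod_conj (c *: f).
Proof.
move=> [g gP fg]; exists (c *: g); first exact: super_invZ.
by rewrite -scalerBr -mulr_algl conj_ideal_mul.
Qed.

Lemma mod_conj_super f : super_inv f -> mod_conj f.
Proof. by exists f => //; rewrite subrr rpred0. Qed.

Lemma mod_conj_ideal f : f \in conj_ideal -> mod_conj f.
Proof. by exists 0; [exact: super_inv0 | rewrite subr0]. Qed.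

Lemma mod_conj_sum (I : Type) (r : seq I) (F : I -> symfun) :
  (forall i, mod_conj (F i)) -> mod_conj (\sum_(i <- r) F i).
Proof.
move=> FP; elim/big_rec: _ => [|i f _ fP]; first exact/mod_conj_super/super_inv0.
exact: mod_conjD.
Qed.

Lemma mod_conj_esf r : mod_conj (esf r).
Proof.
elim/ltn_ind: r => -[|r] IH; first by rewrite esf0; exact/mod_conj_super/super_inv1.
(* The two extreme terms of E^2 give 2 e_(r+1), the inner ones involve smaller indices, and the last
   sum, measuring H - E, lies in the ideal since a column is the conjugate of a row. *)
have qE : qsf r.+1 = 2%:R *: esf r.+1 + (\sum_(i < r) esf i.+1 * esf (r - i) +
   \sum_(i < r.+2) esf (r.+1 - i) * (schurS (row_part i) - schurS (conj_part (row_part i)))).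
  have -> : qsf r.+1 = \sum_(i < r.+2) esf i * esf (r.+1 - i) +
     \sum_(i < r.+2) esf (r.+1 - i) * (schurS (row_part i) - schurS (conj_part (row_part i))).
    rewrite -big_split; apply: eq_bigr => i _ /=.
    by rewrite schurS_col (mulrC (esf (_ - _))) -mulrDl addrC subrK.
  rewrite addrA; congr (_ + _); rewrite big_ord_recl big_ord_recr /= subn0 subnn esf0 mul1r mulr1.
  rewrite scaler_nat mulr2n [in LHS]addrA addrAC; congr (_ + _).
have -> : esf r.+1 = (2%:R^-1 : rat) *: (qsf r.+1 + (-1) *: (\sum_(i < r) esf i.+1 * esf (r - i) +
   \sum_(i < r.+2) esf (r.+1 - i) * (schurS (row_part i) - schurS (conj_part (row_part i))))).
  by rewrite qE scaleN1r addrK scalerA mulVf // scale1r.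
apply/mod_conjZ/mod_conjD; first exact/mod_conj_super/qsf_super_inv.
apply/mod_conjZ/mod_conjD.
  apply: mod_conj_sum => i; apply: mod_conjM; apply: IH; have := ltn_ord i; lia.
by apply: mod_conj_sum => i; apply: mod_conj_ideal; apply: mem_conj_ideal.
Qed.

Lemma mod_conjT f : mod_conj f.
Proof.
apply: symfun_ind f.
- exact: mod_conjD.
- exact: mod_conjM.
- exact: mod_conjZ.
- exact/mod_conj_super/super_inv0.
- exact/mod_conj_super/super_inv1.
- exact: mod_conj_esf.
Qed.

(** * Doubly symmetric elements of the ideal vanish *)

Lemma conv_sqrt (R : comAlgType rat) (a : nat -> R) : a 0%N = 1 ->
  exists2 v : nat -> R, v 0%N = 1 & conv v v = a.
Proof.
move=> a0.
(* [sq n] lists the coefficients 0 to n of the root; the next one solves a_(n+1) = 2 v_(n+1) +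
   products of earlier coefficients. *)
pose fix sq n : seq R := if n is m.+1 then
  rcons (sq m) ((2%:R^-1 : rat) *: (a n - \sum_(i < m) (sq m)`_i.+1 * (sq m)`_(m - i)))
  else [:: 1].
pose v n := (sq n)`_n.
have sz n : size (sq n) = n.+1 by elim: n => //= n IH; rewrite size_rcons IH.
have stable n i : (i <= n)%N -> (sq n)`_i = v i.
  elim: n => [|n IH]; first by rewrite leqn0 => /eqP ->.
  rewrite leq_eqVlt => /orP [/eqP -> //|ilt]; rewrite /= nth_rcons sz ilt; exact: IH.
exists v => //; apply/funext => -[|n].
  by rewrite /conv big_ord1 /= mulr1 a0.
have vS : v n.+1 = (2%:R^-1 : rat) *: (a n.+1 - \sum_(i < n) v i.+1 * v (n - i)%N).
  rewrite {1}/v /= nth_rcons sz ltnn eqxx; congr (_ *: (_ - _)); apply: eq_bigr => i _.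
  by rewrite !stable // leq_subr.
rewrite /conv big_ord_recl big_ord_recr /= subn0 subnn mulr1 mul1r.
rewrite [X in _ + X]addrC addrA -mulr2n -scaler_nat vS scalerA mulfV // scale1r.
by rewrite subrK.
Qed.

Lemma super_inv_conj0 f : super_inv f -> f \in conj_ideal -> f = 0.
Proof.
move=> [d0 fP] /conj_idealP [ps fE].
have [n /(_ n (leqnn n)) ft] := poly_esf_coords f.
pose y i := if (i < n)%N then var_seq n i else var_seq n (i - n).
have y2 i : (i < n)%N -> y i = var_seq n i /\ y (n + i)%N = var_seq n i.
  by move=> ilt; rewrite /y ilt ltnNge leq_addr /= addKn.
pose lq : (n + n).-tuple {mpoly rat[n]} := [tuple y i | i < n + n].
pose d := maxn d0 (\max_(p <- ps) maxn (jt_bound p.2) (jt_bound (conj_part p.2))).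
have super_h_lq s r : comp_mpoly lq (super_h (var_seq (n + n)) s (n + n) r) = super_h y s (n + n) r.
  rewrite rmorph_super_h; apply: (congr1 (@^~ r)); apply: eq_super_h => // i ilt /=.
  by rewrite -[i in var_seq _ i]/(val (Ordinal ilt)) var_seqE comp_mpolyXU -tnth_nth tnth_mktuple.
(* At Y = X a letter contributes both (1 + xt) and 1/(1 - xt), so exchanging
   primed and unprimed letters changes nothing: this specialisation kills the
   ideal. *)
have self_dual : super_h y (leq n) (n + n) = super_h y (negb \o leq n) (n + n).
  rewrite !(super_h_double _ y2) convC.
  by congr conv; apply: eq_super_h => // i ilt /=; rewrite leq_addr leqNgt ilt.
have f2 : ev (n + n) f \mPo lq = 0.
  rewrite -(fP d (leq_maxl _ _) n n) comp_mpoly_esf_subst.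
  have -> : comp_mpoly lq \o super_h (var_seq (n + n)) (negb \o leq n) (n + n) =
     super_h y (negb \o leq n) (n + n) by apply/funext => r; apply: super_h_lq.
  rewrite fE rmorph_sum big_seq big1 // => p pps.
  have : (maxn (jt_bound p.2) (jt_bound (conj_part p.2)) <= d)%N.
    apply: leq_trans (leq_maxr _ _).
    exact: (leq_bigmax_seq (F := fun p => maxn (jt_bound p.2) (jt_bound (conj_part p.2)))).
  rewrite geq_max => /andP [b1 b2].
  (* The dual formula for S_la and the direct one for its conjugate give determinants of the same
     shape [conj_part p.2], differing only in their series. *)
  rewrite rmorphM rmorphB /= esf_subst_schurS_jt ?super_h_0 //.
  rewrite esf_subst_schurS // (super_schur_jt _ _ _ (leqnn _)).
  by rewrite self_dual subrr mulr0.
(* The generic series 1 + X_0 z + ... + X_(n-1) z^n, which becomes E when e_(i+1) is substituted for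
   X_i. *)
pose X' r : {mpoly rat[n]} := if r is r'.+1 then var_seq n r' else 1.
have X'E r : X' r \mPo [tuple mesym n rat i.+1 | i < n] = mesym n rat r.
  case: r => [|r]; first by rewrite comp_mpoly1 mesym0E.
  rewrite /= /var_seq; case: insubP => [i _ <-|].
    by rewrite comp_mpolyXU -tnth_nth tnth_mktuple.
  by rewrite -leqNgt => nr; rewrite comp_mpoly0 mesym_geqnE.
(* By algebraic independence, f(X, X) = 0 says that the coordinate polynomial of f vanishes at the
   coefficients of the squared generic series. *)
have u0 : esf_coords n f \mPo [tuple conv X' X' i.+1 | i < n] = 0.
  apply: (@msym_fundamental_un0 n rat); rewrite comp_mpolyA -f2 -{2}ft ev_poly_esf comp_mpolyA.
  congr (_ \mPo _); apply: eq_from_tnth => i; rewrite !tnth_mktuple.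
  rewrite -super_h_mesym super_h_lq (super_h_double _ y2) rmorph_conv /=.
  by apply: eq_bigr => j _; rewrite /= !X'E !super_h_mesym.
have [v v0 vv] := @conv_sqrt {mpoly rat[n]} X' erefl.
have X'v r : (r <= n)%N -> X' r \mPo [tuple v i.+1 | i < n] = v r.
  case: r => [|r] rn; first by rewrite comp_mpoly1 v0.
  by rewrite /= -[r]/(val (Ordinal rn)) var_seqE comp_mpolyXU -tnth_nth tnth_mktuple.
(* Substituting the coefficients of v turns the generic series into v up to degree n, hence its
   square into v^2, which is the generic series again: the squaring is undone. *)
have t0 : esf_coords n f = 0.
  rewrite -[LHS]comp_mpoly_id -(comp_mpoly0 [tuple v i.+1 | i < n]) -u0 comp_mpolyA.
  congr (_ \mPo _); apply: eq_from_tnth => i; rewrite !tnth_mktuple.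
  rewrite rmorph_conv -var_seqE -[LHS]/(X' i.+1) -[in LHS]vv; apply: eq_bigr => j _ /=.
  by rewrite !X'v //; have := ltn_ord i; have := ltn_ord j; lia.
by rewrite -ft t0 /poly_esf msupp0 big_nil.
Qed.

Theorem corollary2p5 :
  exists (hD : GRing.subring_closed doubly_symmetric)
         (phi : {rmorphism subring_of hD -> {ideal_quot conj_ideal}}),
    bijective phi.
Proof.
pose hD := doubly_symmetric_closed.
pose phi : {rmorphism subring_of hD -> {ideal_quot conj_ideal}} :=
  (\pi_({ideal_quot conj_ideal})%qT \o (\val : subring_of hD -> symfun)).
exists hD, phi.
have phi_inj : injective phi.
  move=> f g /eqP; rewrite -Quotient.idealrBE => fgI; apply/val_inj/eqP.
  rewrite -subr_eq0; apply/eqP/super_inv_conj0 => //.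
  by apply: super_invB; apply/doubly_symmetricP; apply: valP.
have phi_surj q : exists f, phi f == q.
  (* A representative of q is congruent to a doubly symmetric g, whose class is therefore q. *)
  have [g /doubly_symmetricP gD fg] := mod_conjT (generic_quotient.repr q).
  exists (SubringOf (gD : g \in subring_pred hD)).
  by rewrite -[q]reprK eq_sym -Quotient.idealrBE.
exists (fun q => xchoose (phi_surj q)) => [f|q]; last exact/eqP/(xchooseP (phi_surj q)).
by apply: phi_inj; apply/eqP/(xchooseP (phi_surj (phi f))).
Qed.
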